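(* Let $A,B_0,\dots,B_{n-1}$ be $\Sigma^0_2$ sets such that $(A,B_0,\dots,B_{n-1})$ is an Ahmad $n$-pair, and suppose $B_i$ is essential. Then $B_i$ is $\mathrm{high}_2$. In particular, if $(A,B_0,\dots,B_{n-1})$ is a proper Ahmad $n$-pair, then $B_j$ is $\mathrm{high}_2$ for every $j<n$.
   Context: $\le_e$ is enumeration reducibility ($A=\Gamma(B)$ for some c.e. set $\Gamma$ of axioms $\langle x,D\rangle$, $D$ finite); $<_e$ as usual. With $(\Gamma_e)_e$ a listing of c.e. sets, $K_X=\bigoplus_e\Gamma_e(X)$ and the enumeration jump is $X'=K_X\oplus(\omega\setminus K_X)$; $0'_e=\emptyset'$, $0'''_e=\emptyset'''$. $\Sigma^0_2$ sets are those $\le_e 0'_e$; all sets considered are $\Sigma^0_2$. $X$ is $\mathrm{high}_2$ if $X''\ge_e 0'''_e$. $(A,B_0,\dots,B_{n-1})$ is an Ahmad $n$-pair if $A\not\le_e B_i$ for all $i<n$ and every $Z<_e A$ satisfies $Z\le_e B_i$ for some $i<n$. In such an $n$-pair, $B_i$ is essential if there is $C$ with $C<_e A$ and $C<_e B_i$ such that $C\not\le_e B_j$ for all $j\ne i$; the $n$-pair is proper if every $B_i$ is essential. *)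

(* Defs.v *)
From Stdlib Require Cantor.
From mathcomp Require Import all_boot.
From mathcomp Require Import classical_sets.

Set Implicit Arguments.
Unset Strict Implicit.
Unset Printing Implicit Defensive.

Local Open Scope classical_set_scope.

Definition cpair (x y : nat) : nat := Cantor.to_nat (x, y).

(* Unary partial recursive functions; several arguments are passed through the
   Cantor pairing, which is a bijection from nat * nat to nat. *)
Inductive code : Type :=
| Zero | Succ | Fst | Snd
| Pair of code & code
| Comp of code & code
| Prec of code & code
| Find of code.

(* [eval c x y]: the program [c] halts on input [x] with output [y]. *)
Inductive eval : code -> nat -> nat -> Prop :=
| eval_Zero x : eval Zero x 0
| eval_Succ x : eval Succ x x.+1
| eval_Fst x y : eval Fst (cpair x y) x
| eval_Snd x y : eval Snd (cpair x y) y
| eval_Pair c d x y z :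
    eval c x y -> eval d x z -> eval (Pair c d) x (cpair y z)
| eval_Comp c d x y z :
    eval d x y -> eval c y z -> eval (Comp c d) x z
| eval_Prec0 c d x y :
    eval c x y -> eval (Prec c d) (cpair x 0) y
| eval_PrecS c d x k y z :
    eval (Prec c d) (cpair x k) y -> eval d (cpair x (cpair k y)) z ->
    eval (Prec c d) (cpair x k.+1) z
| eval_Find c x m (f : nat -> nat) :
    eval c (cpair x m) 0 ->
    (forall k, k < m -> eval c (cpair x k) (f k).+1) ->
    eval (Find c) x m.

Fixpoint godel (c : code) : nat :=
  match c with
  | Zero => 0
  | Succ => 1
  | Fst => 2
  | Snd => 3
  | Pair c d => 4 * cpair (godel c) (godel d) + 4
  | Comp c d => 4 * cpair (godel c) (godel d) + 5
  | Prec c d => 4 * cpair (godel c) (godel d) + 6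
  | Find c => 4 * godel c + 7
  end.

(* The standard listing of the c.e. sets, as domains of the partial recursive
   functions. *)
Definition W (e : nat) : set nat :=
  [set x | exists c, godel c = e /\ exists y, eval c x y].

Definition ce (S : set nat) : Prop := exists e, S = W e.

(* The finite set with canonical index [u]: [x] belongs to it iff the binary
   digit of weight [2 ^ x] in [u] is 1. *)
Definition finset_of (u : nat) : set nat := [set x | odd (u %/ 2 ^ x)].

(* [cpair x u] codes the axiom <x, D> with D the finite set of index [u]. *)
Definition enum_op (G X : set nat) : set nat :=
  [set x | exists u, G (cpair x u) /\ finset_of u `<=` X].

Definition le_e (X Y : set nat) : Prop :=
  exists G, ce G /\ X = enum_op G Y.

Definition lt_e (X Y : set nat) : Prop := le_e X Y /\ ~ le_e Y X.

Definition join (X Y : set nat) : set nat :=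
  [set z | exists x, z = x.*2 /\ X x] `|` [set z | exists y, z = y.*2.+1 /\ Y y].

Definition bigjoin (X : nat -> set nat) : set nat :=
  [set z | exists e x, z = cpair e x /\ X e x].

Definition K (X : set nat) : set nat := bigjoin (fun e => enum_op (W e) X).

Definition jump (X : set nat) : set nat := join (K X) (~` K X).

Definition Sigma02 (X : set nat) : Prop := le_e X (jump set0).

Definition high2 (X : set nat) : Prop :=
  le_e (jump (jump (jump set0))) (jump (jump X)).

Definition Ahmad_pair (n : nat) (A : set nat) (B : 'I_n -> set nat) : Prop :=
  (forall i, ~ le_e A (B i)) /\
  (forall Z, lt_e Z A -> exists i, le_e Z (B i)).

Definition essential (n : nat) (A : set nat) (B : 'I_n -> set nat) (i : 'I_n)
  : Prop :=
  exists C, [/\ lt_e C A, lt_e C (B i) &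
                forall j, j <> i -> ~ le_e C (B j)].

Definition proper_Ahmad_pair (n : nat) (A : set nat) (B : 'I_n -> set nat)
  : Prop :=
  Ahmad_pair A B /\ forall i, essential A B i.

(* Main.v *)
(** Let [C] witness that [B_i] is essential: then [C] lies below [A], and every [Z] with
    [C <=_e Z <_e A] is below [B := B_i], because the other [B_j] do not
    even bound [C].

    Such [Z] come from a thickness lemma.  Given [V <=_e A] all of whose columns
    are [<=_e C], there is [Z] with [V <= Z <=_e A] whose columns differ
    finitely from those of [V] and with [A] not [<=_e Z].  To keep [A] different
    from the [n]-th operator [W_n(Z)], each apparent agreement of [A_s] with
    [W_n(Z)] up to [y] is preserved by throwing the use lying in columns above [n]
    into [Z], conditionally on [A_s] below [y] and on the use in the columns up
    to [n].  If [A = W_n(Z)], the low columns, hence [C], enumerate [A]; otherwise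
    only finitely many elements are thrown in effectively.

    A first application codes each [y] of [A] into a full column: [Z <=_e B]
    yields that the complement of [A] is [<=_e B'].  Applied to [K_A] in place
    of [A], this makes every set [<=_e A] decidable in [B'].  For the
    second, write [x \in K_{0''}] as "some [a] satisfies
    [E(x,a,b)] for all [b]" with [E] c.e., and let the column [a] of [V_x] be [A]
    restricted to the [y] such that [E(x,a,b)] for all [b <= y].  Then [Z_x <=_e B]
    iff [x] is not in [K_{0''}], and the equation [Z_x = W_u(B)] is
    [Pi^0_1] in [B'], so the complement of [K_{0''}] is [<=_e B'']. *)

Require Import Defs.
From Stdlib Require Cantor.
From mathcomp Require Import all_boot.
From mathcomp Require Import boolp classical_sets.
From mathcomp Require Import zify.

Set Implicit Arguments.
Unset Strict Implicit.
Unset Printing Implicit Defensive.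

Local Open Scope classical_set_scope.

(** * Computable functions *)

Definition pi1 (p : nat) : nat := (Cantor.of_nat p).1.
Definition pi2 (p : nat) : nat := (Cantor.of_nat p).2.

Lemma pi1_cpair x y : pi1 (cpair x y) = x.
Proof. by rewrite /pi1 /cpair Cantor.cancel_of_to. Qed.

Lemma pi2_cpair x y : pi2 (cpair x y) = y.
Proof. by rewrite /pi2 /cpair Cantor.cancel_of_to. Qed.

Definition cpairE := (pi1_cpair, pi2_cpair).

Lemma cpairK p : cpair (pi1 p) (pi2 p) = p.
Proof. by rewrite /cpair /pi1 /pi2 -surjective_pairing Cantor.cancel_to_of. Qed.

Lemma cpair_inj x y x' y' : cpair x y = cpair x' y' -> x = x' /\ y = y'.
Proof.
by move=> e; split; [rewrite -(pi1_cpair x y) | rewrite -(pi2_cpair x y)];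
   rewrite e cpairE.
Qed.

Lemma cpair_ge x y : x + y <= cpair x y.
Proof. by have := Cantor.to_nat_non_decreasing x y; rewrite /cpair; lia. Qed.

Lemma pi_le p : pi1 p <= p /\ pi2 p <= p.
Proof. by have := cpair_ge (pi1 p) (pi2 p); rewrite cpairK; lia. Qed.

(** The indices [cpair x y] in [eval] are not constructor forms, so plain inversion only yields
    equations between codes; phrasing it with the projections makes every later case analysis a
    rewriting. *)
Lemma eval_inv c x y : eval c x y ->
  match c with
  | Zero => y = 0
  | Succ => y = x.+1
  | Fst => y = pi1 x
  | Snd => y = pi2 x
  | Pair c d => eval c x (pi1 y) /\ eval d x (pi2 y)
  | Comp c d => exists2 m, eval d x m & eval c m y
  | Prec c d =>
      if pi2 x is k.+1 then
        exists2 r, eval (Prec c d) (cpair (pi1 x) k) r &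
          eval d (cpair (pi1 x) (cpair k r)) y
      else eval c (pi1 x) y
  | Find c => eval c (cpair x y) 0 /\
      forall k, k < y -> exists v, eval c (cpair x k) v.+1
  end.
Proof.
case=> {c x y} [x|x|x y|x y|c d x y z|c d x y z|c d x y|c d x k y z|c x m f];
  rewrite ?cpairE //.
- by exists y.
- by exists y.
- by move=> e1 e2; split=> // k /e2; exists (f k).
Qed.

Lemma eval_det c x y z : eval c x y -> eval c x z -> y = z.
Proof.
elim: c x y z => [||||c IHc d IHd|c IHc d IHd|c IHc d IHd|c IHc] x y z.
1-4: by move=> /eval_inv-> /eval_inv->.
- move=> /eval_inv[e1 e2] /eval_inv[e3 e4].
  by rewrite -(cpairK y) -(cpairK z) (IHc _ _ _ e1 e3) (IHd _ _ _ e2 e4).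
- move=> /eval_inv[m e1 e2] /eval_inv[m' e3 e4].
  by rewrite (IHd _ _ _ e3 e1) in e4; apply: IHc e2 e4.
(* [Prec c d] calls itself, so an induction on the counter is nested inside the induction on
   codes. *)
- rewrite -(cpairK x); elim: (pi2 x) y z => [|k IHk] y z.
    by move=> /eval_inv + /eval_inv; rewrite !cpairE; apply: IHc.
  move=> /eval_inv + /eval_inv; rewrite !cpairE => -[r e1 e2] [r' e3 e4].
  by rewrite (IHk _ _ e3 e1) in e4; apply: IHd e2 e4.
- move=> /eval_inv[e1 e2] /eval_inv[e3 e4].
  case: (ltngtP y z) => // [/e4|/e2] [v ev].
    by have := IHc _ _ _ e1 ev.
  by have := IHc _ _ _ e3 ev.
Qed.

Definition computable (f : nat -> nat) : Prop :=
  exists c, forall x, eval c x (f x).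

Definition computable2 (f : nat -> nat -> nat) : Prop :=
  computable (fun p => f (pi1 p) (pi2 p)).

Definition dec2 (R : nat -> nat -> bool) : Prop :=
  computable (fun p => R (pi1 p) (pi2 p) : nat).

Definition dec3 (R : nat -> nat -> nat -> bool) : Prop :=
  computable (fun p => R (pi1 p) (pi1 (pi2 p)) (pi2 (pi2 p)) : nat).

Definition dec4 (R : nat -> nat -> nat -> nat -> bool) : Prop :=
  computable (fun p => R (pi1 p) (pi1 (pi2 p)) (pi1 (pi2 (pi2 p)))
                         (pi2 (pi2 (pi2 p))) : nat).

Lemma eq_computable f g : f =1 g -> computable f -> computable g.
Proof. by move=> e [c h]; exists c => x; rewrite -e. Qed.

Lemma computable_comp f g :
  computable f -> computable g -> computable (fun x => f (g x)).
Proof.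
move=> [c hc] [d hd]; exists (Comp c d) => x.
by apply: eval_Comp (hd x) (hc _).
Qed.

Lemma computable_pi1 f : computable f -> computable (fun x => pi1 (f x)).
Proof.
apply: (@computable_comp pi1); exists Fst => x.
by rewrite -{1}(cpairK x); constructor.
Qed.

Lemma computable_pi2 f : computable f -> computable (fun x => pi2 (f x)).
Proof.
apply: (@computable_comp pi2); exists Snd => x.
by rewrite -{1}(cpairK x); constructor.
Qed.

Lemma computable_pair f g : computable f -> computable g ->
  computable (fun x => cpair (f x) (g x)).
Proof.
by move=> [c hc] [d hd]; exists (Pair c d) => x; constructor.
Qed.

Lemma computable_id : computable (fun x => x).
Proof.
apply: (eq_computable cpairK).
apply: computable_pair; [exists Fst | exists Snd] => x;
  by rewrite -{1}(cpairK x); constructor.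
Qed.

Lemma computable_S f : computable f -> computable (fun x => (f x).+1).
Proof. by apply: (@computable_comp S); exists Succ => x; constructor. Qed.

Lemma computable_cst k : computable (fun _ => k).
Proof.
elim: k => [|k IH]; first by exists Zero => x; constructor.
exact: computable_S IH.
Qed.

Lemma computable_comp2 f a b : computable2 f -> computable a -> computable b ->
  computable (fun x => f (a x) (b x)).
Proof.
move=> cf ca cb.
apply: eq_computable (computable_comp cf (computable_pair ca cb)) => x.
by rewrite !cpairE.
Qed.

Lemma dec_comp2 R a b : dec2 R -> computable a -> computable b ->
  computable (fun x => R (a x) (b x) : nat).
Proof. exact: (@computable_comp2 (fun x y => R x y : nat)). Qed.

Lemma dec_comp3 R a b c : dec3 R ->
  computable a -> computable b -> computable c ->
  computable (fun x => R (a x) (b x) (c x) : nat).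
Proof.
move=> cf ca cb cc.
apply: eq_computable (computable_comp cf
  (computable_pair ca (computable_pair cb cc))) => x.
by rewrite !cpairE.
Qed.

Lemma dec_comp4 R a b c d : dec4 R ->
  computable a -> computable b -> computable c -> computable d ->
  computable (fun x => R (a x) (b x) (c x) (d x) : nat).
Proof.
move=> cf ca cb cc cd.
apply: eq_computable (computable_comp cf
  (computable_pair ca (computable_pair cb (computable_pair cc cd)))) => x.
by rewrite !cpairE.
Qed.

Fixpoint primrec (a : nat) (h : nat -> nat -> nat) (n : nat) : nat :=
  if n is k.+1 then h k (primrec a h k) else a.

Lemma computable_rec g b (h : nat -> nat -> nat -> nat) :
  computable g -> computable b ->
  computable (fun p => h (pi1 p) (pi1 (pi2 p)) (pi2 (pi2 p))) ->
  computable (fun x => primrec (g x) (h x) (b x)).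
Proof.
move=> [c hc] cb [d hd].
suff: computable2 (fun x => primrec (g x) (h x)).
  by move/computable_comp2; apply=> //; exact: computable_id.
exists (Prec c d) => p; rewrite -{1}(cpairK p).
elim: (pi2 p) => [|k IH] /=; first exact: eval_Prec0.
apply: eval_PrecS IH _; move: (primrec _ _ k) => r.
by have := hd (cpair (pi1 p) (cpair k r)); rewrite !cpairE.
Qed.

(** A conditional is a recursion of length 0 or 1. *)
Lemma computable_if (P : nat -> bool) f g :
  computable (fun x => P x : nat) -> computable f -> computable g ->
  computable (fun x => if P x then f x else g x).
Proof.
move=> cP cf cg.
apply: (@eq_computable (fun x => primrec (g x) (fun _ _ => f x) (P x))).
  by move=> x; case: (P x).
apply: computable_rec => //.
exact: computable_comp cf (computable_pi1 computable_id).
Qed.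

Lemma computable_negb (P : nat -> bool) : computable (fun x => P x : nat) ->
  computable (fun x => ~~ P x : nat).
Proof.
move=> cP.
apply: (@eq_computable (fun x => if P x then 0 else 1)).
  by move=> x; case: (P x).
by apply: computable_if => //; exact: computable_cst.
Qed.

Lemma computable_andb (P Q : nat -> bool) : computable (fun x => P x : nat) ->
  computable (fun x => Q x : nat) -> computable (fun x => P x && Q x : nat).
Proof.
move=> cP cQ.
apply: (@eq_computable (fun x => if P x then Q x : nat else 0)).
  by move=> x; case: (P x).
by apply: computable_if => //; exact: computable_cst.
Qed.

Lemma computable_orb (P Q : nat -> bool) : computable (fun x => P x : nat) ->
  computable (fun x => Q x : nat) -> computable (fun x => P x || Q x : nat).
Proof.
move=> cP cQ.
apply: (@eq_computable (fun x => if P x then 1 else Q x : nat)).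
  by move=> x; case: (P x).
by apply: computable_if => //; exact: computable_cst.
Qed.

Lemma computable_implyb (P Q : nat -> bool) : computable (fun x => P x : nat) ->
  computable (fun x => Q x : nat) -> computable (fun x => P x ==> Q x : nat).
Proof.
move=> cP cQ.
apply: (@eq_computable (fun x => if P x then Q x : nat else 1)).
  by move=> x; case: (P x).
by apply: computable_if => //; exact: computable_cst.
Qed.

(** * Bounded quantifiers and basic arithmetic *)

Definition ball (n : nat) (P : nat -> bool) : bool := all P (iota 0 n).
Definition bex (n : nat) (P : nat -> bool) : bool := has P (iota 0 n).

Lemma ballP n (P : nat -> bool) : reflect (forall k, k < n -> P k) (ball n P).
Proof.
apply: (iffP allP) => h k; first by move=> kn; apply: h; rewrite mem_iota.
by rewrite mem_iota => /h.
Qed.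

Lemma bexP n (P : nat -> bool) : reflect (exists2 k, k < n & P k) (bex n P).
Proof.
by apply: (iffP hasP) => -[k kn Pk]; exists k => //; rewrite mem_iota in kn *.
Qed.

Lemma computable_bex b (P : nat -> nat -> bool) :
  computable b -> computable (fun p => P (pi1 p) (pi2 p) : nat) ->
  computable (fun x => bex (b x) (P x) : nat).
Proof.
move=> cb cP.
apply: (@eq_computable
  (fun x => primrec 0 (fun k r => if P x k then 1 else r) (b x))).
  move=> x; rewrite /bex; elim: (b x) => // n IH.
  rewrite -[in RHS](addn1 n) iotaD has_cat /= orbF {}IH.
  by case: (P x n); rewrite ?orbT ?orbF.
apply: computable_rec => //; first exact: computable_cst.
have c2 := computable_pi2 computable_id.
apply: (computable_if (P := fun p => P (pi1 p) (pi1 (pi2 p)))).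
- apply: (dec_comp2 cP (computable_pi1 computable_id)).
  exact: computable_pi1.
- exact: computable_cst.
- exact: computable_pi2.
Qed.

Lemma computable_ball b (P : nat -> nat -> bool) :
  computable b -> computable (fun p => P (pi1 p) (pi2 p) : nat) ->
  computable (fun x => ball (b x) (P x) : nat).
Proof.
move=> cb cP.
apply: (@eq_computable (fun x => ~~ bex (b x) (fun k => ~~ P x k) : nat)).
  by move=> x; rewrite /bex /ball has_predC negbK.
apply/computable_negb/computable_bex => //.
exact: computable_negb cP.
Qed.

Lemma computable2_addn : computable2 addn.
Proof.
apply: (@eq_computable (fun p => primrec (pi1 p) (fun _ r => r.+1) (pi2 p))).
  by move=> p; elim: (pi2 p) => [|k /= ->]; rewrite ?addn0 ?addnS.
have ci := computable_id.
apply: computable_rec; [exact: computable_pi1|exact: computable_pi2|].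
by apply/computable_S/computable_pi2/computable_pi2.
Qed.

Lemma computable_pred : computable predn.
Proof.
apply: (@eq_computable (fun p => primrec 0 (fun k _ => k) p)); first by case.
have ci := computable_id.
apply: computable_rec => //; first exact: computable_cst.
by apply/computable_pi1/computable_pi2.
Qed.

Lemma computable2_subn : computable2 subn.
Proof.
apply: (@eq_computable (fun p => primrec (pi1 p) (fun _ r => r.-1) (pi2 p))).
  by move=> p; elim: (pi2 p) => [|k /= ->]; rewrite ?subn0 ?subnS.
have ci := computable_id.
apply: computable_rec; [exact: computable_pi1|exact: computable_pi2|].
by apply: (computable_comp computable_pred); apply/computable_pi2/computable_pi2.
Qed.

Lemma dec2_eq : dec2 (fun x y => x == y).
Proof.
apply: (@eq_computable (fun p => if pi1 p - pi2 p + (pi2 p - pi1 p) is _.+1 then 0 else 1)).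
  by move=> p; case: eqP; case E: (_ + _) => //; lia.
apply: (@eq_computable (fun p => primrec 1 (fun _ _ => 0)
   (pi1 p - pi2 p + (pi2 p - pi1 p)))); first by move=> p; case: (_ + _).
have c1 := computable_pi1 computable_id.
have c2 := computable_pi2 computable_id.
apply: computable_rec; [exact: computable_cst| |exact: computable_cst].
by apply: (computable_comp2 computable2_addn); apply: (computable_comp2 computable2_subn).
Qed.

Lemma dec2_leq : dec2 leq.
Proof.
have c1 := computable_pi1 computable_id.
have c2 := computable_pi2 computable_id.
apply: (dec_comp2 dec2_eq); last exact: computable_cst.
exact: (computable_comp2 computable2_subn).
Qed.

(** Computability is proved by following the syntax of the function. Auxiliary relations are looked
    up in the context, which is why later proofs first bring facts such as [dec2_bit] there. *)
Ltac comp_step :=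
  cbv beta;
  match goal with
  | H : ?P |- ?P => exact H
  | |- computable (fun x => x) => apply computable_id
  | |- computable pi1 => apply (computable_pi1 computable_id)
  | |- computable pi2 => apply (computable_pi2 computable_id)
  | |- computable (cpair ?a) =>
      apply (computable_pair (computable_cst a) computable_id)
  | |- computable S => apply (computable_S computable_id)
  | |- computable (fun x => ?k) => apply (computable_cst k)
  | |- computable (fun x => pi1 _) => apply computable_pi1
  | |- computable (fun x => pi2 _) => apply computable_pi2
  | |- computable (fun x => cpair _ _) => apply computable_pair
  | |- computable (fun x => S _) => apply computable_S
  | |- computable (fun x => predn (@?a x)) =>
      apply (@computable_comp predn a computable_pred)
  | |- computable (fun x => addn (@?a x) (@?b x)) =>
      apply (@computable_comp2 addn a b computable2_addn)
  | |- computable (fun x => subn (@?a x) (@?b x)) =>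
      apply (@computable_comp2 subn a b computable2_subn)
  | |- computable (fun x => nat_of_bool (leq (@?a x) (@?b x))) =>
      apply (@dec_comp2 leq a b dec2_leq)
  | |- computable (fun x => nat_of_bool (eq_op (@?a x) (@?b x))) =>
      apply (@dec_comp2 (fun x y => x == y) a b dec2_eq)
  | |- computable (fun x => nat_of_bool (andb _ _)) => apply computable_andb
  | |- computable (fun x => nat_of_bool (orb _ _)) => apply computable_orb
  | |- computable (fun x => nat_of_bool (implb _ _)) => apply computable_implyb
  | |- computable (fun x => nat_of_bool (negb _)) => apply computable_negb
  | |- computable (fun x => nat_of_bool (ball (@?b x) (@?P x))) =>
      apply (@computable_ball b P)
  | |- computable (fun x => nat_of_bool (bex (@?b x) (@?P x))) =>
      apply (@computable_bex b P)
  | |- computable (fun x => if _ then _ else _) => apply computable_if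
  | |- computable (fun x => primrec (@?g x) (@?h x) (@?b x)) =>
      apply (@computable_rec g b h)
  | H : dec2 ?R |- computable (fun x => nat_of_bool (?R (@?a x) (@?b x))) =>
      apply (@dec_comp2 R a b H)
  | H : dec3 ?R |- computable (fun x => nat_of_bool (?R (@?a x) (@?b x) (@?c x))) =>
      apply (@dec_comp3 R a b c H)
  | H : dec4 ?R |- computable (fun x => nat_of_bool (?R (@?a x) (@?b x) (@?c x) (@?d x))) =>
      apply (@dec_comp4 R a b c d H)
  | H : computable2 ?R |- computable (fun x => ?R (@?a x) (@?b x)) =>
      apply (@computable_comp2 R a b H)
  | H : computable ?f |- computable (fun x => ?f (@?a x)) =>
      apply (@computable_comp f a H)
  end.

Ltac comp := rewrite /dec2 /dec3 /dec4 /computable2; repeat comp_step.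

(** * Finite sets coded by binary digits *)

Definition bit (u x : nat) : bool := odd (u %/ 2 ^ x).

(** A code bounds the elements of its set, so quantifiers over a coded finite set become bounded and
    decidable. *)
Lemma bit_lt u x : bit u x -> x < u.
Proof.
rewrite /bit => h; case: (leqP (2 ^ x) u) => [|lt].
  by apply: leq_trans; apply: ltn_expl.
by rewrite divn_small in h.
Qed.

Lemma dec2_bit : dec2 bit.
Proof.
have chalf : computable half.
  (* The half of [k + 1] is [k] minus the half of [k], a recursion without case distinction. *)
  apply: (@eq_computable (fun x => primrec 0 (fun k r => k - r) x)); last by comp.
  elim=> // k IH; rewrite [primrec _ _ _]/= IH -[half k.+1]/(uphalf k).
  rewrite uphalf_half -{1}(odd_double_half k) -addnn.
  by rewrite addnA addnK.
(* The outer recursion computes the parity by flipping, the inner one divides by a power of 2 by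
   repeated halving. *)
apply: (@eq_computable (fun p => primrec 0 (fun _ r => 1 - r)
  (primrec (pi1 p) (fun _ r => half r) (pi2 p)))); last by comp.
move=> p; rewrite /bit; set u := primrec (pi1 p) _ _.
have -> : pi1 p %/ 2 ^ pi2 p = u.
  rewrite /u; elim: (pi2 p) => [|k IH] /=; first by rewrite divn1.
  by rewrite -IH expnSr divnMA divn2.
by elim: u => //= k ->; case: (odd k).
Qed.

(** This is a canonical index; the powers of 2 are written as iterated doublings to keep it visibly
    primitive recursive. *)
Definition compr (n : nat) (P : nat -> bool) : nat :=
  primrec 0 (fun k r => r + (if P k then primrec 1 (fun _ m => m + m) k else 0)) n.

Lemma compr_lt n P : compr n P < 2 ^ n.
Proof.
rewrite /compr; elim: n => //= n IH.
have -> : primrec 1 (fun _ m => m + m) n = 2 ^ n.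
  by elim: n {IH} => //= n ->; rewrite expnS; lia.
by rewrite expnS; case: (P n); lia.
Qed.

Lemma bit_compr n P z : bit (compr n P) z = (z < n) && P z.
Proof.
elim: n => [|n IH]; first by rewrite /bit /compr /= div0n.
have := compr_lt n P; move: IH; rewrite /compr /=.
have -> : primrec 1 (fun _ m => m + m) n = 2 ^ n.
  by elim: n => //= n ->; rewrite expnS; lia.
move: (primrec 0 _ n) => r; rewrite /bit => IH rn.
case: (ltngtP z n) => [zn|zn|->].
- rewrite zn /= in IH; rewrite ltnS (ltnW zn) /= -IH.
  case: (P n); last by rewrite addn0.
  have -> : 2 ^ n = 2 ^ (n - z) * 2 ^ z by rewrite -expnD subnK // ltnW.
  rewrite addnC divnMDl ?expn_gt0 // oddD oddX /=.
  by have -> : n - z == 0 = false by lia.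
- rewrite ltnNge zn /= divn_small //.
  have : 2 ^ n.+1 <= 2 ^ z by rewrite leq_exp2l.
  by rewrite expnS; case: (P n); lia.
- rewrite ltnSn /=; case: (P n); last by rewrite addn0 divn_small.
  by rewrite addnC -{1}(mul1n (2 ^ n)) divnMDl ?expn_gt0 // divn_small.
Qed.

Lemma computable_compr b (P : nat -> nat -> bool) :
  computable b -> computable (fun p => P (pi1 p) (pi2 p) : nat) ->
  computable (fun x => compr (b x) (P x)).
Proof.
by move=> cb cP; have {}cP : dec2 P by []; rewrite /compr; comp.
Qed.

(** * A universal c.e. relation *)

(** Lists are coded as nested pairs without their length, so access is total and the length is
    carried separately. *)
Definition nthc (w i : nat) : nat := pi1 (primrec w (fun _ r => pi2 r) i).

Lemma computable2_nthc : computable2 nthc.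
Proof. by rewrite /nthc; comp. Qed.

Fixpoint encode (l : seq nat) : nat :=
  if l is a :: l' then cpair a (encode l') else 0.

Lemma nthc_encode l i : i < size l -> nthc (encode l) i = nth 0 l i.
Proof.
rewrite /nthc; elim: l i => // a l IH [|i] /=; first by rewrite pi1_cpair.
rewrite ltnS => /IH <-.
congr pi1; elim: i {IH} => [|i IHi]; first exact: pi2_cpair.
by rewrite /= IHi.
Qed.

(* [just ex e]: the judgement "program number [pi1 e] maps [pi1 (pi2 e)] to
   [pi2 (pi2 e)]" follows in one step from judgements [e'] whose availability
   is tested by [ex]. *)
Definition just (ex : (nat -> bool) -> bool) (e : nat) : bool :=
  let c := pi1 e in let x := pi1 (pi2 e) in let y := pi2 (pi2 e) in
  ((c == 0) && (y == 0)) ||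
  (((c == 1) && (y == x.+1)) ||
  (((c == 2) && (y == pi1 x)) ||
  (((c == 3) && (y == pi2 x)) ||
  (bex c (fun p => (c == p + p + (p + p) + 4) &&
    (ex (fun e' => e' == cpair (pi1 p) (cpair x (pi1 y))) &&
     ex (fun e' => e' == cpair (pi2 p) (cpair x (pi2 y))))) ||
  (bex c (fun p => (c == p + p + (p + p) + 5) &&
    ex (fun e' => (pi1 e' == pi2 p) && ((pi1 (pi2 e') == x) &&
      ex (fun e'' => e'' == cpair (pi1 p) (cpair (pi2 (pi2 e')) y))))) ||
  (bex c (fun p => (c == p + p + (p + p) + 6) &&
    ((pi2 x == 0) && ex (fun e' => e' == cpair (pi1 p) (cpair (pi1 x) y)))) ||
  (bex c (fun p => (c == p + p + (p + p) + 6) &&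
    ((0 < pi2 x) &&
      ex (fun e' => (pi1 e' == c) &&
        ((pi1 (pi2 e') == cpair (pi1 x) (pi2 x).-1) &&
         ex (fun e'' => e'' == cpair (pi2 p) (cpair
           (cpair (pi1 x) (cpair (pi2 x).-1 (pi2 (pi2 e')))) y)))))) ||
  bex c (fun p => (c == p + p + (p + p) + 7) &&
    (ex (fun e' => e' == cpair p (cpair (cpair x y) 0)) &&
     ball y (fun k => ex (fun e' => (pi1 e' == p) &&
       ((pi1 (pi2 e') == cpair x k) && (0 < pi2 (pi2 e')))))))))))))).

Definition valid (w n : nat) : bool :=
  ball n (fun i => just (fun P => bex i (fun j => P (nthc w j))) (nthc w i)).

(** A form of Kleene's T-predicate: [s] packs a coded derivation, its length and the output of the
    computation. *)
Definition Wb (e x s : nat) : bool :=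
  let w := pi1 s in let n := pi1 (pi2 s) in let y := pi2 (pi2 s) in
  valid w n && bex n (fun i => nthc w i == cpair e (cpair x y)).

Lemma dec3_Wb : dec3 Wb.
Proof.
have c := computable2_nthc; rewrite /Wb /valid /just; cbv zeta.
comp.
Qed.

(** The residue modulo 4 selects the constructor of a compound program. [WbP] uses this to turn an
    arbitrary index back into a program. *)
Lemma godel_surj e : exists c, godel c = e.
Proof.
elim/ltn_ind: e => -[|[|[|[|e]]]] IH.
- by exists Zero.
- by exists Succ.
- by exists Fst.
- by exists Snd.
have [q [r [rlt eE]]] : exists q r, r < 4 /\ e = 4 * q + r.
  exists (e %/ 4), (e %% 4); rewrite ltn_mod; split=> //.
  by rewrite {1}(divn_eq e 4) mulnC.
have [le1 le2] := pi_le q.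
have [|c1 e1] := IH (pi1 q); first lia.
have [|c2 e2] := IH (pi2 q); first lia.
have [|c3 e3] := IH q; first lia.
have qE := cpairK q.
case: r rlt eE => [|[|[|[|//]]]] _ eE.
- by exists (Pair c1 c2); rewrite /= e1 e2 qE; lia.
- by exists (Comp c1 c2); rewrite /= e1 e2 qE; lia.
- by exists (Prec c1 c2); rewrite /= e1 e2 qE; lia.
- by exists (Find c3); rewrite /= e3; lia.
Qed.

Lemma godel_inj : injective godel.
Proof.
elim=> [||||c1 IH1 c2 IH2|c1 IH1 c2 IH2|c1 IH1 c2 IH2|c1 IH1]
  [||||d1 d2|d1 d2|d1 d2|d1] /= e //; try lia.
1-3: by have [|/IH1-> /IH2->] := @cpair_inj (godel c1) (godel c2) (godel d1) (godel d2);
  first lia.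
by rewrite (IH1 d1) //; lia.
Qed.

Definition holds (e : nat) : Prop :=
  forall c, godel c = pi1 e -> eval c (pi1 (pi2 e)) (pi2 (pi2 e)).

(** The clauses of [just] mirror the constructors of [eval]. The availability test stays abstract:
    all that matters is that it only finds judgements which hold. *)
Lemma just_sound (ex : (nat -> bool) -> bool) e :
  (forall P, ex P -> exists2 e', P e' & holds e') -> just ex e -> holds e.
Proof.
move=> exP; rewrite /just; set x := pi1 (pi2 e); set y := pi2 (pi2 e).
have ex1 p a b : ex (fun e' => e' == cpair p (cpair a b)) ->
    forall c, godel c = p -> eval c a b.
  by move=> /exP[_ /eqP-> h] c cE; have := h c; rewrite !cpairE; apply.
move=> H c ce; rewrite -/x -/y -ce in H *; move: H.
case/orP=> [/andP[/eqP cc /eqP ->]|].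
  by case: c ce cc => //= *; try lia; exact: eval_Zero.
case/orP=> [/andP[/eqP cc /eqP ->]|].
  by case: c ce cc => //= *; try lia; exact: eval_Succ.
case/orP=> [/andP[/eqP cc /eqP ->]|].
  case: c ce cc => //= *; try lia.
  by rewrite -{1}(cpairK x); exact: eval_Fst.
case/orP=> [/andP[/eqP cc /eqP ->]|].
  case: c ce cc => //= *; try lia.
  by rewrite -{1}(cpairK x); exact: eval_Snd.
case/orP=> [/bexP[p _ /andP[/eqP cc /andP[/ex1 h1 /ex1 h2]]]|].
  case: c ce cc => //=; try lia.
  move=> c1 c2 _ cc; have {cc} pE : p = cpair (godel c1) (godel c2) by lia.
  rewrite pE !cpairE in h1 h2.
  by rewrite -(cpairK y); apply: eval_Pair; auto.
case/orP=> [/bexP[p _ /andP[/eqP cc /exP[e' /andP[/eqP p2 /andP[/eqP xE /ex1 h1]] h2]]]|].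
  case: c ce cc => //=; try lia.
  move=> c1 c2 _ cc; have {cc} pE : p = cpair (godel c1) (godel c2) by lia.
  rewrite pE !cpairE in h1 p2.
  by apply: eval_Comp (h1 _ erefl); rewrite -xE; apply: h2.
case/orP=> [/bexP[p _ /andP[/eqP cc /andP[/eqP x0 /ex1 h1]]]|].
  case: c ce cc => //=; try lia.
  move=> c1 c2 _ cc; have {cc} pE : p = cpair (godel c1) (godel c2) by lia.
  rewrite pE !cpairE in h1.
  by rewrite -(cpairK x) x0; apply: eval_Prec0; auto.
case/orP=> [/bexP[p _ /andP[/eqP cc /andP[x0
    /exP[e' /andP[/eqP p2 /andP[/eqP xE /ex1 h1]] h2]]]]|].
  case: c ce cc p2 => //=; try lia.
  move=> c1 c2 ce cc p2; have {cc} pE : p = cpair (godel c1) (godel c2) by lia.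
  rewrite pE !cpairE in h1.
  rewrite -(cpairK x) -(prednK x0); apply: eval_PrecS (h1 _ erefl).
  by rewrite -xE; apply: h2; rewrite /= p2.
case/bexP=> [p _ /andP[/eqP cc /andP[/ex1 h1 /ballP h2]]].
case: c ce cc => //=; try lia.
move=> c1 ce cc; have {cc} pE : p = godel c1 by lia.
rewrite pE in h1 h2.
(* [eval_Find] wants the earlier values as a function, so a dummy value is supplied from [y] on
   before choice is applied. *)
have {}h2 k : exists v, k < y -> eval c1 (cpair x k) v.+1.
  case: (ltnP k y) => [|_]; last by exists 0.
  case/h2/exP=> e' /andP[/eqP p1 /andP[/eqP xE v0]] h.
  by exists (pi2 (pi2 e')).-1 => _; rewrite (prednK v0) -xE; apply: h.
have [f fP] := choice h2.
by apply: (@eval_Find _ _ _ f); auto.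
Qed.

Lemma valid_sound w n i : valid w n -> i < n -> holds (nthc w i).
Proof.
move=> /ballP v; elim/ltn_ind: i => i IH lt.
apply: just_sound (v i lt) => P /bexP[j ji Pj].
by exists (nthc w j) => //; apply: IH => //; apply: ltn_trans lt.
Qed.

(** Derivations as lists growing at the end, easier to extend than the coded form [valid], to which
    [deriv_valid] leads. *)
Inductive deriv : seq nat -> Prop :=
| deriv_nil : deriv [::]
| deriv_rcons l e : deriv l -> just (has^~ l) e -> deriv (rcons l e).

Lemma deriv_valid l : deriv l -> valid (encode l) (size l).
Proof.
move=> d; apply/ballP=> i il.
suff: just (has^~ (take i l)) (nth 0 l i).
  rewrite nthc_encode //; congr just; apply: funext => P.
  have -> : bex i (fun j => P (nthc (encode l) j)) = has (P \o nth 0 l) (iota 0 i).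
    apply: eq_in_has => j; rewrite mem_iota /= => ji.
    by rewrite nthc_encode //; apply: ltn_trans il.
  rewrite -(has_map (nth 0 l)); congr (has P _).
  rewrite -[LHS](mkseq_nth 0) size_take il.
  apply/eq_in_map => j; rewrite mem_iota /= => ji.
  by rewrite nth_take.
elim: d il => // {}l e d IH je; rewrite size_rcons ltnS leq_eqVlt.
case/orP=> [/eqP->|il]; rewrite nth_rcons -cats1.
  by rewrite ltnn eqxx take_size_cat.
by rewrite il takel_cat ?(ltnW il)//; apply: IH.
Qed.

(** Prolonging an arbitrary derivation [l] lets the derivations of several premises be chained
    before the final step is added. *)
Lemma deriv_complete c x y : eval c x y -> forall l, deriv l ->
  exists2 l', deriv (l ++ l') & cpair (godel c) (cpair x y) \in l ++ l'.
Proof.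
have step l l' e : deriv (l ++ l') -> just (has^~ (l ++ l')) e ->
    exists2 l', deriv (l ++ l') & e \in l ++ l'.
  move=> d j; exists (rcons l' e); rewrite -rcons_cat.
    exact: deriv_rcons.
  by rewrite mem_rcons inE eqxx.
have hasE l (e : nat) : has (fun e' => e' == e) l = (e \in l).
  by rewrite -has_pred1.
have sub l l' (e : nat) : e \in l -> e \in l ++ l' by rewrite mem_cat => ->.
move: c x y.
elim=> [||||c1 IH1 c2 IH2|c1 IH1 c2 IH2|c1 IH1 c2 IH2|c1 IH1] x y.
- by move=> /eval_inv-> l d; apply: (step l [::]);
    rewrite cats0 // /just !cpairE.
- by move=> /eval_inv-> l d; apply: (step l [::]);
    rewrite cats0 // /just !cpairE eqxx.
- by move=> /eval_inv-> l d; apply: (step l [::]);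
    rewrite cats0 // /just !cpairE eqxx !orbT.
- by move=> /eval_inv-> l d; apply: (step l [::]);
    rewrite cats0 // /just !cpairE eqxx !orbT.
- move=> /eval_inv[h1 h2] l d.
  have [l1 d1 m1] := IH1 _ _ h1 _ d.
  have [l2 d2 m2] := IH2 _ _ h2 _ d1.
  rewrite -catA in d2 m2; apply: step d2 _; rewrite /just !cpairE.
  do 4 (apply/orP; right); apply/orP; left.
  apply/bexP; exists (cpair (godel c1) (godel c2)); first by rewrite /=; lia.
  rewrite !cpairE !hasE m2 catA sub // !andbT.
  by apply/eqP; rewrite /=; lia.
- move=> /eval_inv[m h1 h2] l d.
  have [l1 d1 m1] := IH2 _ _ h1 _ d.
  have [l2 d2 m2] := IH1 _ _ h2 _ d1.
  rewrite -catA in d2 m2; apply: step d2 _; rewrite /just !cpairE.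
  do 5 (apply/orP; right); apply/orP; left.
  apply/bexP; exists (cpair (godel c1) (godel c2)); first by rewrite /=; lia.
  apply/andP; split; first by apply/eqP; rewrite /=; lia.
  apply/hasP; eexists; first by rewrite catA; exact: sub m1.
  by rewrite !cpairE !eqxx /= hasE.
- rewrite -(cpairK x); elim: (pi2 x) y => [|k IHk] y /eval_inv; rewrite !cpairE.
    move=> h1 l d; have [l1 d1 m1] := IH1 _ _ h1 _ d.
    apply: step d1 _; rewrite /just !cpairE.
    do 6 (apply/orP; right); apply/orP; left.
    apply/bexP; exists (cpair (godel c1) (godel c2)); first by rewrite /=; lia.
    rewrite !cpairE !hasE m1 !andbT.
    by apply/eqP; rewrite /=; lia.
  move=> [r h1 h2] l d.
  have [l1 d1 m1] := IHk _ h1 _ d.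
  have [l2 d2 m2] := IH2 _ _ h2 _ d1.
  rewrite -catA in d2 m2; apply: step d2 _; rewrite /just !cpairE.
  do 7 (apply/orP; right); apply/orP; left.
  apply/bexP; exists (cpair (godel c1) (godel c2)); first by rewrite /=; lia.
  apply/andP; split; first by apply/eqP; rewrite /=; lia.
  apply/hasP; eexists; first by rewrite catA; exact: sub m1.
  by rewrite !cpairE !eqxx /= hasE.
- move=> /eval_inv[h1 h2] l d.
  have [l1 d1 m1] := IH1 _ _ h1 _ d.
  (* All nonzero values below [y] are collected in one extension, by induction on the bound. *)
  have [l2 d2 m2] : exists2 l2, deriv ((l ++ l1) ++ l2) &
      forall k, k < y -> exists v,
        cpair (godel c1) (cpair (cpair x k) v.+1) \in (l ++ l1) ++ l2.
    elim: {-2}y (leqnn y) => [|j IHj] jy; first by exists [::]; rewrite ?cats0.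
    have [l2 d2 m2] := IHj (ltnW jy).
    have [v hv] := h2 _ jy.
    have [l3 d3 m3] := IH1 _ _ hv _ d2.
    rewrite -[(_ ++ _) ++ l3]catA in d3 m3.
    exists (l2 ++ l3) => // k; rewrite ltnS leq_eqVlt => /orP[/eqP->|/m2[v' h]].
      by exists v.
    by exists v'; rewrite catA sub.
  rewrite -catA in d2 m2; apply: step d2 _; rewrite /just !cpairE.
  do 8 (apply/orP; right).
  apply/bexP; exists (godel c1); first by rewrite /=; lia.
  apply/and3P; split; first by apply/eqP; rewrite /=; lia.
    by rewrite hasE catA sub.
  apply/ballP=> k /m2[v h].
  by apply/hasP; eexists; first exact: h; rewrite !cpairE !eqxx.
Qed.

Lemma WbP e x : W e x <-> exists s, Wb e x s.
Proof.
split=> [[c [ce [y /deriv_complete]]]|[s /andP[v /bexP[i il /eqP h]]]].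
  case/(_ _ deriv_nil) => l d m.
  exists (cpair (encode l) (cpair (size l) y)).
  rewrite /Wb !cpairE deriv_valid //=; apply/bexP.
  exists (index (cpair e (cpair x y)) l); rewrite -ce ?index_mem //.
  by rewrite nthc_encode ?index_mem // nth_index.
have [c ce] := godel_surj e; exists c; split=> //.
have := valid_sound v il; rewrite h => /(_ c); rewrite !cpairE => /(_ ce) ev.
by eexists; exact: ev.
Qed.

(** The unbounded search for a witness halts exactly on [S]. *)
Lemma ce_exists (R : nat -> nat -> bool) (S : set nat) :
  dec2 R -> (forall x, S x <-> exists s, R x s) -> ce S.
Proof.
move=> cR SE.
have [c hc] : computable (fun p => ~~ R (pi1 p) (pi2 p) : nat).
  by comp.
exists (godel (Find c)); apply/seteqP; split=> x.
  move=> /SE ex; exists (Find c); split=> //.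
  have [m Rm mmin] := ex_minnP ex.
  exists m; apply: (@eval_Find _ _ _ (fun => 0)) => [|k km].
    by have := hc (cpair x m); rewrite !cpairE Rm.
  have := hc (cpair x k); rewrite !cpairE; case: (boolP (R x k)) => // /mmin.
  by rewrite leqNgt km.
case=> d [/godel_inj -> [y /eval_inv[/eval_det/(_ (hc _))]]].
by rewrite !cpairE; case: (boolP (R x y)) => // Rxy _ _; apply/SE; exists y.
Qed.

(** * Closure properties of enumeration reducibility *)

(** Working form of a reduction: one witness [k] carries the finite set of an axiom in [pi1 k] and,
    in [pi2 k], further data such as a stage of its enumeration. A decidable relation thus replaces
    the c.e. set of axioms. *)
Lemma le_e_intro (R : nat -> nat -> bool) (S X : set nat) : dec2 R ->
  (forall x, S x <-> exists2 k, R x k & finset_of (pi1 k) `<=` X) -> le_e S X.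
Proof.
move=> cR SE; exists [set p | exists s, R (pi1 p) (cpair (pi2 p) s)]; split.
  apply: (@ce_exists (fun p s => R (pi1 p) (cpair (pi2 p) s))) => //.
  by comp.
apply/seteqP; split=> x; rewrite /enum_op /=.
  move=> /SE[k Rk uX]; exists (pi1 k); split=> //.
  by exists (pi2 k); rewrite !cpairE cpairK.
move=> [u [[s Rs] uX]]; rewrite !cpairE in Rs.
by apply/SE; exists (cpair u s); rewrite ?cpairE.
Qed.

Lemma enum_op_W e X x : enum_op (W e) X x <->
  exists2 k, Wb e (cpair x (pi1 k)) (pi2 k) & finset_of (pi1 k) `<=` X.
Proof.
split=> [[u [/WbP[s h] uX]]|[k h uX]].
  by exists (cpair u s); rewrite ?cpairE.
by exists (pi1 k); split=> //; apply/WbP; exists (pi2 k).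
Qed.

Lemma le_e_W S X : le_e S X -> exists e, forall x, S x <-> enum_op (W e) X x.
Proof. by move=> [G [[e ->] ->]]; exists e. Qed.

Lemma le_e_elim (S X : set nat) : le_e S X -> exists2 R, dec2 R &
  forall x, S x <-> exists2 k, R x k & finset_of (pi1 k) `<=` X.
Proof.
move=> /le_e_W[e he]; have cW := dec3_Wb.
exists (fun x k => Wb e (cpair x (pi1 k)) (pi2 k)); first by comp.
by move=> x; rewrite he enum_op_W.
Qed.

Lemma eq_le_e (S T X : set nat) : (forall x, S x <-> T x) ->
  le_e S X -> le_e T X.
Proof. by move=> e; have -> : S = T by apply/seteqP; split=> x /e. Qed.

Lemma le_e_pre (T X : set nat) f : computable f -> le_e T X ->
  le_e (fun x => T (f x)) X.
Proof.
move=> cf /le_e_elim[R cR RE].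
by apply: (@le_e_intro (fun x k => R (f x) k)); first by comp.
Qed.

Lemma le_e_dec (P : nat -> bool) X : computable (fun x => P x : nat) ->
  le_e (fun x => P x) X.
Proof.
move=> cP; apply: (@le_e_intro (fun x k => P x && (pi1 k == 0))).
  have {}cP : dec2 (fun x _ => P x) by apply: computable_comp cP _; comp.
  by rewrite /dec2; apply: computable_andb; last by comp.
move=> x; split=> [Px|[k /andP[]//]].
exists (cpair 0 0); rewrite !cpairE ?Px //= => z.
by rewrite /finset_of /= div0n.
Qed.

Lemma compr_exists (P : nat -> Prop) n : (forall z, P z -> z < n) ->
  exists u, forall z, bit u z <-> P z.
Proof.
move=> h; exists (compr n (fun z => `[<P z>])) => z; rewrite bit_compr.
by split=> [/andP[_ /asboolP]|Pz]; last by rewrite h //; apply/asboolP.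
Qed.

Lemma le_e_refl X : le_e X X.
Proof.
have cb := dec2_bit.
apply: (@le_e_intro (fun x k => bit (pi1 k) x)); first by comp.
move=> x; split=> [Xx|[k h]]; last exact.
have [u uE] := @compr_exists (fun z => z = x) x.+1 (fun z => ltac:(lia)).
exists (cpair u 0); rewrite !cpairE; first exact/uE.
by move=> z /uE ->.
Qed.

Definition fsub (u v : nat) : bool := ball u (fun z => bit u z ==> bit v z).

Lemma fsubP u v : reflect (forall z, bit u z -> bit v z) (fsub u v).
Proof.
apply: (iffP (ballP _ _)) => [h z uz|h z _]; last by apply/implyP/h.
by apply: (implyP (h z (bit_lt uz))).
Qed.

Lemma dec2_fsub : dec2 fsub.
Proof. by have cb := dec2_bit; rewrite /fsub; comp. Qed.

Lemma bigcup_code (b : nat) (f : nat -> nat) :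
  exists u, forall z, bit u z <-> exists2 k, k < b & bit (f k) z.
Proof.
apply: (@compr_exists _ (\sum_(k < b) f k)) => z [k kb /bit_lt].
move=> lt; apply: leq_trans lt _.
by rewrite (bigD1 (Ordinal kb)) //= leq_addr.
Qed.

Lemma le_e_ex (S : nat -> nat -> Prop) X :
  le_e (fun p => S (pi1 p) (pi2 p)) X -> le_e (fun x => exists k, S x k) X.
Proof.
move=> /le_e_elim[R cR RE].
apply: (@le_e_intro (fun x k =>
  R (cpair x (pi1 (pi2 k))) (cpair (pi1 k) (pi2 (pi2 k))))); first by comp.
move=> x; split=> [[k Sxk]|[k Rk h]].
  have /(RE (cpair x k))[k' Rk' h] : S (pi1 (cpair x k)) (pi2 (cpair x k)).
    by rewrite !cpairE.
  by exists (cpair (pi1 k') (cpair k (pi2 k'))); rewrite !cpairE // cpairK.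
exists (pi1 (pi2 k)).
have : S (pi1 (cpair x (pi1 (pi2 k)))) (pi2 (cpair x (pi1 (pi2 k)))).
  by apply/RE; eexists; first exact: Rk; rewrite cpairE.
by rewrite !cpairE.
Qed.

(** The union of the finite sets used for all [k < b x] serves as one axiom; the second component of
    the new witness bounds the search for the individual ones. *)
Lemma le_e_ball (b : nat -> nat) (S : nat -> nat -> Prop) X : computable b ->
  le_e (fun p => S (pi1 p) (pi2 p)) X ->
  le_e (fun x => forall k, k < b x -> S x k) X.
Proof.
move=> cb /le_e_elim[R cR RE].
have {}RE x z : S x z <->
    exists2 k, R (cpair x z) k & finset_of (pi1 k) `<=` X.
  by have := RE (cpair x z); rewrite !cpairE.
have cf := dec2_fsub.
apply: (@le_e_intro (fun x k => ball (b x) (fun z => bex (pi2 k) (fun k' =>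
  R (cpair x z) k' && fsub (pi1 k') (pi1 k))))); first by comp.
move=> x; split=> [h|[k /ballP h1 h2] z zb]; last first.
  have /bexP[k' _ /andP[Rk /fsubP sub]] := h1 z zb.
  by apply/RE; exists k' => // j jk; apply: h2; apply: sub.
have /choice[f fP] : forall z, exists k, z < b x ->
    R (cpair x z) k /\ finset_of (pi1 k) `<=` X.
  move=> z; case: (ltnP z (b x)) => [/h/RE[k Rk sub]|_]; last by exists 0.
  by exists k.
have [u uE] := bigcup_code (b x) (fun z => pi1 (f z)).
exists (cpair u (\sum_(z < b x) f z).+1); rewrite !cpairE; last first.
  by move=> j /uE[z zb]; have [_ ] := fP z zb; apply.
apply/ballP=> z zb; apply/bexP; exists (f z).
  by rewrite ltnS (bigD1 (Ordinal zb)) //= leq_addr.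
have [-> _] := fP z zb; rewrite /=.
by apply/fsubP => j jz; apply/uE; exists z.
Qed.

Lemma le_e_or (S T X : set nat) : le_e S X -> le_e T X ->
  le_e (fun x => S x \/ T x) X.
Proof.
move=> /le_e_elim[R cR RE] /le_e_elim[R' cR' RE'].
apply: (@le_e_intro (fun x k => R x (cpair (pi1 k) (pi2 (pi2 k))) ||
  R' x (cpair (pi1 k) (pi2 (pi2 k))))); first by comp.
move=> x; rewrite RE RE'; split.
  by case=> -[k h sub]; exists (cpair (pi1 k) (cpair 0 (pi2 k)));
    rewrite !cpairE // cpairK h ?orbT.
by case=> k /orP[] h sub; [left|right];
  exists (cpair (pi1 k) (pi2 (pi2 k))); rewrite ?cpairE.
Qed.

Lemma le_e_and (S T X : set nat) : le_e S X -> le_e T X ->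
  le_e (fun x => S x /\ T x) X.
Proof.
move=> /le_e_elim[R cR RE] /le_e_elim[R' cR' RE'].
have cf := dec2_fsub.
apply: (@le_e_intro (fun x k =>
  (R x (pi1 (pi2 k)) && fsub (pi1 (pi1 (pi2 k))) (pi1 k)) &&
  (R' x (pi2 (pi2 k)) && fsub (pi1 (pi2 (pi2 k))) (pi1 k)))); first by comp.
move=> x; rewrite RE RE'; split.
  case=> -[k h sub] [k' h' sub'].
  have [u uE] := bigcup_code 2 (fun i => if i == 0 then pi1 k else pi1 k').
  exists (cpair u (cpair k k')); rewrite !cpairE; last first.
    by move=> j /uE[[|[|//]] _]; [exact: sub|exact: sub'].
  rewrite h h' /=; apply/andP; split; apply/fsubP => j jk; apply/uE.
    by exists 0.
  by exists 1.
case=> k /andP[/andP[h /fsubP s] /andP[h' /fsubP s']] sub.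
by split; eexists; try eassumption; move=> j jk; apply: sub; [apply: s|apply: s'].
Qed.

(** Membership in [X] is an existential statement over a bounded conjunction of facts about [Y], so
    the closure lemmas produce the composed operator. *)
Lemma le_e_trans (Y X Z : set nat) : le_e X Y -> le_e Y Z -> le_e X Z.
Proof.
move=> /le_e_elim[R cR RE] YZ; have cb := dec2_bit.
apply: (@eq_le_e (fun x => exists k, R x k /\
  forall z, z < pi1 k -> ~~ bit (pi1 k) z \/ Y z)).
  move=> x; rewrite RE; split=> -[k].
    move=> [Rk h]; exists k => // z bz.
    by case: (h z (bit_lt bz)) => //; rewrite [bit _ _]bz.
  move=> Rk h; exists k; split=> // z _.
  by case: (boolP (bit (pi1 k) z)) => [/h|]; [right|left].
apply: le_e_ex; apply: le_e_and; first by apply: le_e_dec; comp.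
apply: (@le_e_ball (fun p => pi1 (pi2 p))
  (fun p z => ~~ bit (pi1 (pi2 p)) z \/ Y z)); first by comp.
apply: le_e_or; first by apply: le_e_dec; comp.
by apply: le_e_pre YZ; comp.
Qed.

(** * Joins and the enumeration jump *)

Lemma join_double X Y i : join X Y i.*2 <-> X i.
Proof.
split=> [[[j [e Xj]]|[j [e _]]]|Xi]; last by left; exists i.
  by have -> : i = j by lia.
by lia.
Qed.

Lemma join_doubleS X Y i : join X Y i.*2.+1 <-> Y i.
Proof.
split=> [[[j [e _]]|[j [e Yj]]]|Yi]; last by right; exists i.
  by lia.
by have -> : i = j by lia.
Qed.

Lemma le_e_joinl X Y : le_e X (join X Y).
Proof.
apply: (@eq_le_e (fun x => join X Y (x + x))).
  by move=> x; rewrite addnn join_double.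
by apply: le_e_pre (le_e_refl _); comp.
Qed.

Lemma le_e_joinr X Y : le_e Y (join X Y).
Proof.
apply: (@eq_le_e (fun x => join X Y (x + x).+1)).
  by move=> x; rewrite addnn join_doubleS.
by apply: le_e_pre (le_e_refl _); comp.
Qed.

Lemma join_le_e X Y Z : le_e X Z -> le_e Y Z -> le_e (join X Y) Z.
Proof.
move=> XZ YZ.
apply: (@eq_le_e (fun z => (exists x, z == x + x /\ X x) \/
                           (exists x, z == (x + x).+1 /\ Y x))).
  by move=> z; split=> -[] [x [e h]]; [left|right|left|right]; exists x;
    split=> //; lia.
apply: le_e_or; apply: le_e_ex; apply: le_e_and.
- by apply: le_e_dec; comp.
- by apply: le_e_pre XZ; comp.
- by apply: le_e_dec; comp.
- by apply: le_e_pre YZ; comp.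
Qed.

Lemma KE X e x : K X (cpair e x) <-> enum_op (W e) X x.
Proof.
split=> [[e' [x' [/cpair_inj[-> ->]]]]//|h].
by exists e, x.
Qed.

Lemma le_e_K X : le_e (K X) X.
Proof.
have cW := dec3_Wb.
apply: (@le_e_intro
  (fun p k => Wb (pi1 p) (cpair (pi2 p) (pi1 k)) (pi2 k))); first by comp.
by move=> p; rewrite -{1}(cpairK p) KE enum_op_W.
Qed.

Lemma le_e_jump S X : le_e S X -> le_e S (jump X).
Proof.
move=> /le_e_W[e he].
apply: le_e_trans (le_e_joinl _ _).
apply: (@eq_le_e (fun x => K X (cpair e x))); first by move=> x; rewrite KE he.
by apply: le_e_pre (le_e_refl _); comp.
Qed.

Lemma le_e_jumpC S X : le_e S X -> le_e (~` S) (jump X).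
Proof.
move=> /le_e_W[e he].
apply: le_e_trans (le_e_joinr _ _).
apply: (@eq_le_e (fun x => (~` K X) (cpair e x))).
  by move=> x; rewrite /setC /= KE he.
by apply: le_e_pre (le_e_refl _); comp.
Qed.

Lemma jump_le_e X Y : le_e X Y -> le_e (jump X) (jump Y).
Proof.
move=> XY; have KY := le_e_trans (le_e_K X) XY.
exact: join_le_e (le_e_jump KY) (le_e_jumpC KY).
Qed.

(** Here [a] is an axiom whose even elements are positive and whose odd elements are negative
    queries to [K X]: [P] confirms the axiom and its positive queries, [Q] collects the axioms with
    a refuted negative query. *)
Lemma le_e_jump_elim S X : le_e S (jump X) -> exists P Q : set nat,
  [/\ le_e P X, le_e Q X &
      forall x, S x <-> exists a, P (cpair x a) /\ ~ Q (cpair x a)].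
Proof.
move=> /le_e_elim[R cR RE]; have cb := dec2_bit.
exists (fun p => R (pi1 p) (pi2 p) /\ forall i, i < pi1 (pi2 p) ->
  ~~ bit (pi1 (pi2 p)) (i + i) \/ K X i).
exists (fun p => exists i, bit (pi1 (pi2 p)) (i + i).+1 /\ K X i).
split.
- apply: le_e_and; first by apply: le_e_dec; comp.
  apply: (@le_e_ball (fun p => pi1 (pi2 p))
    (fun p i => ~~ bit (pi1 (pi2 p)) (i + i) \/ K X i)); first by comp.
  apply: le_e_or; first by apply: le_e_dec; comp.
  by apply: le_e_pre (le_e_K X); comp.
- apply: le_e_ex; apply: le_e_and; first by apply: le_e_dec; comp.
  by apply: le_e_pre (le_e_K X); comp.
move=> x; rewrite RE; split=> [[k Rk h]|[k [[Rk h1] h2]]].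
  exists k; rewrite !cpairE; split.
    split=> // i _; case: (boolP (bit _ _)) => [/h|]; last by left.
    by rewrite addnn => /join_double; right.
  by move=> [i [/h]]; rewrite addnn => /join_doubleS.
rewrite !cpairE in Rk h1 h2; exists k => // z bz.
have [o zE] : exists o : bool, z = o + z./2.*2.
  by exists (odd z); rewrite odd_double_half.
case: o zE => zE; rewrite zE in bz *.
  apply/join_doubleS => Kz; apply: h2; exists z./2; split=> //.
  by rewrite addnn.
apply/join_double; have [||//] := h1 z./2.
  by have := bit_lt bz; lia.
by rewrite addnn [bit _ _]bz.
Qed.

Lemma le_e_set0 X : le_e set0 X.
Proof.
apply: (@eq_le_e (fun=> is_true false)) => //.
by apply: (@le_e_dec (fun=> false)); comp.
Qed.

Lemma le_e_set0_elim S : le_e S set0 -> exists2 R, dec2 R &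
  forall x, S x <-> exists k, R x k.
Proof.
move=> /le_e_elim[R cR RE]; have cf := dec2_fsub.
exists (fun x k => R x k && fsub (pi1 k) 0); first by comp.
move=> x; rewrite RE; split=> [[k Rk h]|[k /andP[Rk /fsubP h]]].
  by exists k; rewrite Rk; apply/fsubP => z /h.
by exists k => // z /h; rewrite /bit div0n.
Qed.

(** * Good approximations of Sigma^0_2 sets *)

Definition evt (P : nat -> Prop) : Prop :=
  exists s0, forall s, s0 <= s -> P s.

Lemma evt_mono (P Q : nat -> Prop) :
  (forall s, P s -> Q s) -> evt P -> evt Q.
Proof. by move=> h [s0 hs]; exists s0 => s /hs/h. Qed.

Lemma evt_and (P Q : nat -> Prop) : evt P -> evt Q ->
  evt (fun s => P s /\ Q s).
Proof.
move=> [s hs] [t ht]; exists (maxn s t) => r; rewrite geq_max => /andP[h1 h2].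
by split; [apply: hs|apply: ht].
Qed.

Lemma evt_ge n : evt (fun s => n <= s).
Proof. by exists n. Qed.

Lemma evt_ball (P : nat -> nat -> Prop) n :
  (forall k, k < n -> evt (P^~ k)) -> evt (fun s => forall k, k < n -> P s k).
Proof.
elim: n => [|n IH] h; first by exists 0.
have : evt (fun s => (forall k, k < n -> P s k) /\ P s n).
  by apply: evt_and; [apply: IH => k kn; apply: h; apply: ltnW|apply: h].
apply: evt_mono => s [h1 h2] k; rewrite ltnS leq_eqVlt => /orP[/eqP->//|].
exact: h1.
Qed.

(** A non-element may reappear for ever; convergence is replaced by an unbounded supply of good
    stages, those where the finite approximation is contained in [A]. Large good stages are correct
    on any given initial segment. *)
Record good_approx (A : set nat) (a : nat -> nat -> bool) : Prop := GoodApprox {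
  ga_dec : dec2 a;
  ga_lt : forall s y, a s y -> y < s;
  ga_evt : forall y, A y -> evt (fun s => a s y);
  ga_good : forall s0, exists2 s, s0 <= s & forall y, a s y -> A y }.

(** The answer of [K set0] on [x] is shown only at calm stages, when no number up to [x] is just
    entering. The good stages are the true stages of this enumeration. *)
Lemma good_approx_jump0 : exists2 j, dec2 j &
  (forall z, jump set0 z -> evt (fun s => j s z)) /\
  (forall s0, exists2 s, s0 <= s & forall z, j s z -> jump set0 z).
Proof.
have [R cR RE] := le_e_set0_elim (le_e_K set0).
pose Kb s x := bex s (R x).
have cK : dec2 Kb.
  by rewrite /dec2; apply: (@computable_bex pi1 (fun p k => R (pi2 p) k)); comp.
have KbE x : K set0 x <-> exists s, Kb s x.
  rewrite RE; split=> [[k Rk]|[s /bexP[k _ Rk]]]; last by exists k.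
  by exists k.+1; apply/bexP; exists k.
have Kb_mono s t x : s <= t -> Kb s x -> Kb t x.
  move=> st /bexP[k ks h]; apply/bexP; exists k => //.
  exact: leq_trans st.
have settle x : evt (fun s => Kb s x <-> K set0 x).
  have [/KbE[s h]|nK] := pselect (K set0 x).
    exists s => t st; split=> _; last exact: Kb_mono h.
    by apply/KbE; exists s.
  by exists 0 => s _; split=> // h; apply/KbE; exists s.
pose calm s x := ball x.+1 (fun x' => Kb s x' ==> Kb s.-1 x').
have cc : dec2 calm by rewrite /calm; comp.
pose j s z := bex s (fun x => calm s x &&
  (((z == x + x) && Kb s x) || ((z == (x + x).+1) && ~~ Kb s x))).
exists j; first by rewrite /j; comp.
have jP x s : calm s x -> x < s -> (Kb s x <-> K set0 x) ->
    forall z, jump set0 z -> z./2 = x -> j s z.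
  move=> cs xs e z Jz zx; apply/bexP; exists x => //; rewrite cs /=.
  case: Jz => -[y [zE h]]; have yx : y = x by lia.
    by rewrite yx in zE h; move/e: h => ->; rewrite zE addnn eqxx.
  rewrite yx in zE h; apply/orP; right; rewrite zE addnn eqxx /=.
  by apply/negP => /e.
split=> [z Jz|s0].
  have ev : evt (fun s => forall x, x < (z./2).+1 -> Kb s x <-> K set0 x).
    by apply: evt_ball => x _; apply: settle.
  have [s1 h1] := ev.
  exists (maxn s1 z./2).+1 => s; rewrite ltnNge => hs.
  apply: (@jP z./2 s) => //; try (by lia); last by apply: h1; lia.
  apply/ballP=> x xz; apply/implyP => Kx.
  apply/(h1 s.-1); [lia|by []|].
  by apply/KbE; exists s.
(* The minimum [m] is not calm at some stage from [s0] on, or is itself such a stage; the second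
   alternative guarantees existence when nothing enters any more. At the stage found, calm numbers
   lie below [m], where the enumeration is complete. *)
have ex : exists x, `[<exists2 s, s0 <= s & (x == s) || ~~ calm s x>].
  by exists s0; apply/asboolP; exists s0; rewrite ?eqxx.
have [m /asboolP[s s0s sm] mmin] := ex_minnP ex.
have lowcalm x t : x < m -> s0 <= t -> calm t x.
  move=> xm st; apply/negPn/negP => nc.
  have : m <= x by apply: mmin; apply/asboolP; exists t => //; rewrite nc orbT.
  by rewrite leqNgt xm.
exists s => // z /bexP[x xs /andP[cx h]].
have xm : x < m.
  rewrite ltnNge; apply/negP => mx; case/orP: sm => [/eqP ms|/negP[]]; first lia.
  apply/ballP => k km; move/ballP: cx; apply; lia.
have Kx : K set0 x -> Kb s x.
  move=> /KbE[t]; elim: t => [//|t IH] Kt.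
  case: (leqP t.+1 s) => [ts|st]; first exact: Kb_mono Kt.
  apply: IH; have /ballP/(_ x) := lowcalm x t.+1 xm ltac:(lia).
  by rewrite ltnSn => /(_ isT)/implyP; apply.
case/orP: h => /andP[/eqP-> h]; rewrite addnn.
  by apply/join_double/KbE; exists s.
by apply/join_doubleS => /Kx; apply/negP.
Qed.

(** The reduction is applied to the stages approximating the first jump; good stages of the latter
    are good for [A]. *)
Lemma good_approx_exists A : Sigma02 A -> exists a, good_approx A a.
Proof.
move=> /le_e_elim[R cR RE]; have [j cj [jev jgood]] := good_approx_jump0.
have cb := dec2_bit.
exists (fun s y => (y < s) && bex s (fun k => R y k &&
  ball (pi1 k) (fun z => bit (pi1 k) z ==> j s z))).
split=> [|s y /andP[]//|y /RE[k Rk h]|s0].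
- by comp.
- have ev : evt (fun s => forall z, z < pi1 k -> bit (pi1 k) z -> j s z).
    apply: (evt_ball (P := fun s z => bit (pi1 k) z -> j s z)) => z _.
    case: (boolP (bit (pi1 k) z)) => [/h/jev|_]; first exact: evt_mono.
    by exists 0.
  apply: evt_mono (evt_and ev (evt_ge (maxn y k).+1)) => s [hj hs].
  apply/andP; split; first lia.
  apply/bexP; exists k; first lia.
  by rewrite Rk; apply/ballP => z zk; apply/implyP/hj.
- have [s ss h] := jgood s0; exists s => // y /andP[_ /bexP[k _ /andP[Rk /ballP hk]]].
  apply/RE; exists k => // z bz; apply: h.
  exact: (implyP (hk z (bit_lt bz))).
Qed.

(** * The thickness lemma *)

Lemma eq_bex n (P Q : nat -> bool) : (forall k, k < n -> P k = Q k) ->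
  bex n P = bex n Q.
Proof. by move=> h; apply: eq_in_has => k; rewrite mem_iota => /h. Qed.

Lemma eq_ball n (P Q : nat -> bool) : (forall k, k < n -> P k = Q k) ->
  ball n P = ball n Q.
Proof. by move=> h; apply: eq_in_all => k; rewrite mem_iota => /h. Qed.

Lemma cpair_le x y t : x <= t -> y <= t -> cpair x y <= cpair t t.
Proof.
move=> xt yt; have := Cantor.to_nat_spec x y; have := Cantor.to_nat_spec t t.
by rewrite /cpair; nia.
Qed.

(* [a] approximates the set [A]; [h t z] says that [z] was put into the set
   under construction at stage [t], an action valid only if [A_t] is contained
   in [A]. *)
Section Stages.
Variables (a h : nat -> nat -> bool).

Definition subA t' t := ball t' (fun y => a t' y ==> a t y).

Definition inZ s z := bex s (fun t => subA t s && h t z).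

Definition usable s n q c := bex s (fun w => Wb n (cpair q c) w) &&
  ball c (fun z => bit c z ==> inZ s z).

(** With the least usable axiom, any axiom usable from some stage on bounds all later uses;
    [finite_dump] exploits this. *)
Definition use s n q c :=
  usable s n q c && ball c (fun c' => ~~ usable s n q c').

Definition conv s n q := bex s (fun c => usable s n q c).

Definition agree s n y :=
  ball y.+1 (fun q => (a s q ==> conv s n q) && (conv s n q ==> a s q)).

Definition inuse s n y z :=
  bex y.+1 (fun q => a s q && bex s (fun c => use s n q c && bit c z)).

(* The agreement seen at stage [s] is preserved at stage [t] provided that [t]
   still believes the elements of [A_s] below [y] and the part of the use lying
   in the columns up to [n]; it is this conditioning which makes the
   effective action of each requirement finite. *)
Definition fire s t n y :=
  agree s n y && (ball y (fun q => a s q ==> a t q) &&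
  ball s (fun z => (inuse s n y z && (pi1 z <= n)) ==> inZ t z)).

Definition dump t z := bex t.+1 (fun s => bex s.+1 (fun n => bex s.+1 (fun y =>
  fire s t n y && (inuse s n y z && (n < pi1 z))))).

Lemma inuse_lt s n y z : inuse s n y z -> z < s.
Proof.
case/bexP=> q _ /andP[_ /bexP[c cs /andP[_ /bit_lt zc]]].
exact: ltn_trans cs.
Qed.

End Stages.

Lemma inZ_ext a h h' t s : (forall r, r < t -> h r =1 h' r) -> s <= t ->
  inZ a h s =1 inZ a h' s.
Proof.
move=> e st z; apply: eq_bex => r rs.
by rewrite e //; apply: leq_trans st.
Qed.

Lemma usable_ext a h h' t s n q : (forall r, r < t -> h r =1 h' r) -> s <= t ->
  usable a h s n q =1 usable a h' s n q.
Proof.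
move=> e st c; rewrite /usable; congr andb; apply: eq_ball => z _.
by rewrite (inZ_ext _ e st).
Qed.

Lemma conv_ext a h h' t s n q : (forall r, r < t -> h r =1 h' r) -> s <= t ->
  conv a h s n q = conv a h' s n q.
Proof. by move=> e st; apply: eq_bex => c _; apply: usable_ext e st _. Qed.

Lemma inuse_ext a h h' t s n y : (forall r, r < t -> h r =1 h' r) -> s <= t ->
  inuse a h s n y =1 inuse a h' s n y.
Proof.
move=> e st z; apply: eq_bex => q _; congr andb; apply: eq_bex => c _.
congr andb; rewrite /use (usable_ext _ _ _ e st _); congr andb.
by apply: eq_ball => c' _; rewrite (usable_ext _ _ _ e st _).
Qed.

(** Stage [t] consults only the actions of earlier stages, so the equation defining [h] from [dump]
    is a course-of-values recursion. *)
Lemma dump_ext a h h' t z : (forall r, r < t -> h r =1 h' r) ->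
  dump a h t z = dump a h' t z.
Proof.
move=> e; apply: eq_bex => s; rewrite ltnS => st.
apply: eq_bex => n _; apply: eq_bex => y _.
rewrite /fire (inuse_ext _ _ _ e st).
have -> : agree a h s n y = agree a h' s n y.
  by apply: eq_ball => q _; rewrite (conv_ext _ _ _ e st).
congr [&& _ && (_ && _), _ & _]; apply: eq_ball => k _.
by rewrite (inuse_ext _ _ _ e st) (inZ_ext _ e (leqnn t)).
Qed.

Lemma stages_exist a (v : nat -> nat -> nat -> bool) : dec2 a -> dec3 v ->
  (forall x t z, v x t z -> z < t) ->
  exists2 zs : nat -> nat -> nat -> bool, dec3 zs &
    forall x t z, zs x t z = v x t z || dump a (zs x) t z.
Proof.
move=> ca cv vlt.
pose hist u t z := bit u (cpair t z).
pose new x t u z := v x t z || dump a (hist u) t z.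
(* The history before a stage is one finite set of pairs; actions at stage [t] concern only [z < t],
   so [cpair t t] bounds the new pairs. *)
pose st x t := primrec 0 (fun t u => compr (cpair t t).+1 (fun p =>
  bit u p || ((pi1 p == t) && new x t u (pi2 p)))) t.
pose zs x t z := new x t (st x t) z.
have cb := dec2_bit; have cW := dec3_Wb.
have cnew : dec4 new.
  rewrite /new /dump /fire /agree /inuse /conv /use /usable /inZ /subA /hist.
  by comp.
exists zs.
  pose f x k r := compr (cpair k k).+1 (fun q =>
    bit r q || ((pi1 q == k) && new x k r (pi2 q))).
  have cst : computable2 st.
    apply: (@computable_rec (fun=> 0) pi2 (fun p => f (pi1 p))); [by comp|by comp|].
    apply: (@computable_compr (fun p => (cpair (pi1 (pi2 p)) (pi1 (pi2 p))).+1)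
      (fun p q => bit (pi2 (pi2 p)) q || ((pi1 q == pi1 (pi2 p)) &&
         new (pi1 (pi1 p)) (pi1 (pi2 p)) (pi2 (pi2 p)) (pi2 q)))); by comp.
  by rewrite /zs; comp.
have newlt x t u z : new x t u z -> z < t.
  case/orP=> [/vlt//|/bexP[s st' /bexP[n _ /bexP[y _ /and3P[_ /inuse_lt zs' _]]]]].
  by lia.
have histE x t r : r < t -> hist (st x t) r =1 zs x r.
  move=> rt z; rewrite /hist; elim: t rt => // t IH.
  rewrite ltnS leq_eqVlt => rt.
  rewrite /st /= -/(st x t) bit_compr !cpairE ltnS.
  case/orP: rt => [/eqP<-|rt].
    rewrite eqxx /= -/(zs x r z).
    have -> : bit (st x r) (cpair r z) = false.
      case: {IH} r => [|r]; first by rewrite /bit div0n.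
      rewrite /st /= -/(st x r) bit_compr !cpairE.
      have -> : r.+1 == r = false by lia.
      rewrite orbF; apply/negP => /andP[_].
      (* A history records only stages earlier than its own. *)
      suff bd k : bit (st x k) (cpair r.+1 z) -> r.+1 < k by move=> /bd; lia.
      elim: k => [|k IH]; first by rewrite /bit div0n.
      rewrite /st /= -/(st x k) bit_compr !cpairE => /andP[_ /orP[/IH|]]; lia.
    rewrite /=; case: (boolP (zs x r z)) => [/newlt zr|]; last by rewrite andbF.
    by rewrite cpair_le // ltnW.
  have -> : r == t = false by lia.
  rewrite orbF IH //; case: (boolP (zs x r z)) => [/newlt zr|]; last by rewrite andbF.
  by rewrite cpair_le //; lia.
move=> x t z; rewrite {1}/zs /new; congr orb.
by apply: dump_ext => r rt; apply: histE.
Qed.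

(** * Verification of the construction for a single set *)

Section OneSet.
Variables (A : set nat) (a : nat -> nat -> bool) (ga : good_approx A a).
Variables (h v : nat -> nat -> bool) (V : set nat).
Hypothesis hE : forall t z, h t z = v t z || dump a h t z.
Hypothesis v_evt : forall z, V z -> evt (fun t => v t z).

Definition good t := forall y, a t y -> A y.

Definition limZ : set nat := [set z | exists2 t, good t & h t z].

Hypothesis v_good : forall t z, good t -> v t z -> V z.

Let Om n := enum_op (W n) limZ.

Lemma evt_good P : evt P -> exists2 t, good t & P t.
Proof.
move=> [s0 hs]; have [t st gt] := ga_good ga s0.
by exists t => //; apply: hs.
Qed.

(** The approximation at a good stage is a finite subset of [A], hence contained in almost all later
    approximations. *)
Lemma limZ_evt z : limZ z -> evt (fun t => inZ a h t z).
Proof.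
move=> [t' gt' hz].
have ev : evt (fun t => forall y, y < t' -> a t' y -> a t y).
  apply: (evt_ball (P := fun t y => a t' y -> a t y)) => y _.
  case: (boolP (a t' y)) => [/gt'/(ga_evt ga)|_]; first exact: evt_mono.
  by exists 0.
apply: evt_mono (evt_and ev (evt_ge t'.+1)) => t [sub lt].
apply/bexP; exists t' => //; rewrite hz andbT.
by apply/ballP => y yt; apply/implyP/sub.
Qed.

(** A guess still believed at a good stage is itself contained in [A]. *)
Lemma good_inZ t z : good t -> inZ a h t z -> limZ z.
Proof.
move=> gt /bexP[t' _ /andP[/ballP sub hz]]; exists t' => // y ay.
by apply/gt/(implyP (sub y (ga_lt ga ay))).
Qed.

Lemma sub_limZ z : V z -> limZ z.
Proof.
move=> /v_evt/evt_good[t gt vz]; exists t => //.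
by rewrite hE vz.
Qed.

Lemma usable_Om s n q c : usable a h s n q c ->
  (forall z, bit c z -> limZ z) -> Om n q.
Proof.
move=> /andP[/bexP[w _ Ww] _] sub; apply/enum_op_W.
by exists (cpair c w); rewrite ?cpairE.
Qed.

Lemma good_conv s n q : good s -> conv a h s n q -> Om n q.
Proof.
move=> gs /bexP[c _ us]; apply: usable_Om (us) _ => z cz.
case/andP: us => _ /ballP/(_ z (bit_lt cz)); rewrite cz.
exact: good_inZ.
Qed.

Lemma Om_usable n q : Om n q -> exists c, evt (fun s => usable a h s n q c).
Proof.
move=> /enum_op_W[k Wk sub]; exists (pi1 k).
have ev : evt (fun s => forall z, z < pi1 k -> bit (pi1 k) z -> inZ a h s z).
  apply: (evt_ball (P := fun s z => bit (pi1 k) z -> inZ a h s z)) => z _.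
  case: (boolP (bit (pi1 k) z)) => [/sub/limZ_evt|_]; first exact: evt_mono.
  by exists 0.
apply: evt_mono (evt_and ev (evt_ge (pi2 k).+1)) => s [hs ks].
apply/andP; split; first by apply/bexP; exists (pi2 k).
by apply/ballP => z zk; apply/implyP/hs.
Qed.

Lemma usable_conv s n q c : usable a h s n q c -> c < s -> conv a h s n q.
Proof. by move=> us cs; apply/bexP; exists c. Qed.

Lemma Om_conv n q : Om n q -> evt (fun s => conv a h s n q).
Proof.
move=> /Om_usable[c ev]; apply: evt_mono (evt_and ev (evt_ge c.+1)) => s [us cs].
exact: usable_conv us cs.
Qed.

Lemma conv_use s n q : conv a h s n q -> exists2 c, c < s & use a h s n q c.
Proof.
case/bexP=> c0 c0s u0.
have [c uc cmin] := ex_minnP (ex_intro (usable a h s n q) _ u0).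
exists c; first by apply: leq_ltn_trans c0s; apply: cmin.
rewrite /use uc; apply/ballP => c' cc; apply/negP => /cmin.
by rewrite leqNgt cc.
Qed.

(** The whole use ends up in [limZ]: its part in the columns up to [n] by the condition in [fire],
    the rest through [dump]. Elements of the guess are tested only below [y], yet [q = y] is
    covered; the induction in [low_columns] depends on it. *)
Lemma fire_Om s t n y q : good t -> s <= t -> n <= s -> y <= s ->
  fire a h s t n y -> q <= y -> a s q -> Om n q.
Proof.
move=> gt st ns ys f qy aq; have /and3P[/ballP ag _ /ballP low] := f.
have /andP[/implyP/(_ aq)/conv_use[c cs uc] _] := ag q qy.
have /andP[us _] := uc; apply: usable_Om us _ => z cz.
have iz : inuse a h s n y z.
  apply/bexP; exists q => //; rewrite aq; apply/bexP; exists c => //.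
  by rewrite uc cz.
case: (leqP (pi1 z) n) => zn.
  apply: good_inZ gt _; apply: (implyP (low z _)); last by rewrite iz zn.
  exact: inuse_lt iz.
exists t => //; rewrite hE; apply/orP; right.
apply/bexP; exists s => //; apply/bexP; exists n => //; apply/bexP; exists y => //.
by rewrite f iz zn.
Qed.

(** Let [d] be a disagreement. Once the positive facts about [d] are visible, a fired agreement
    reaching beyond [d] would be genuine at [d]. Hence [y <= d], and only the uses of finitely many
    [q] matter, each eventually bounded by a permanent axiom. *)
Lemma finite_dump n : ~ (forall q, A q <-> Om n q) ->
  exists b, forall s t y z, good t -> s <= t -> n <= s -> y <= s ->
    fire a h s t n y -> inuse a h s n y z -> z < b.
Proof.
move=> /existsNP[d dis].
have /choice[c /choice[s1 cP]] : forall q, exists c s1, Om n q ->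
    forall s, s1 <= s -> usable a h s n q c.
  move=> q.
  have [/Om_usable[c [s1 hs]]|no] := pselect (Om n q); last by exists 0, 0.
  by exists c, s1.
have [s0 s0P] : evt (fun s => (A d -> a s d) /\ (Om n d -> conv a h s n d)).
  apply: evt_and.
    have [/(ga_evt ga)|no] := pselect (A d); first exact: evt_mono.
    by exists 0.
  have [/Om_conv|no] := pselect (Om n d); first exact: evt_mono.
  by exists 0.
(* Elements of a use at stage [s] are below [s], so an element beyond this bound forces [s] beyond
   [s0] and every [s1 q]. *)
exists (s0 + \sum_(q < d.+1) (s1 q + c q)).
move=> s t y z gt st ns ys f iz; rewrite ltnNge; apply/negP => big.
have zs := inuse_lt iz.
have [h1 h2] := s0P s ltac:(lia).
have /and3P[/ballP ag /ballP low _] := f.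
have yd : y <= d.
  rewrite leqNgt; apply/negP => dy; apply: dis.
  have /andP[_ /implyP cd] := ag d (ltnW dy).
  split=> [/h1|/h2/cd] ad; first by apply: fire_Om f _ ad => //; apply: ltnW.
  by apply: gt; apply: (implyP (low d dy)).
case/bexP: iz => q qy /andP[aq /bexP[k ks /andP[/andP[_ /ballP kmin] kz]]].
have qd : q < d.+1 by apply: leq_trans qy _.
have Oq : Om n q by apply: fire_Om f _ aq.
move: big; rewrite (bigD1 (Ordinal qd)) //= => big.
have zk := bit_lt kz.
have uq : usable a h s n q (c q) by apply: cP => //; lia.
by have := kmin (c q) ltac:(lia); rewrite uq.
Qed.

(* If the [n]-th operator did compute [A], the positive information of the low
   columns would suffice to recognise the correct preserved agreements. *)
Lemma low_columns n : dec2 h -> (forall q, A q <-> Om n q) ->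
  le_e A (fun z => pi1 z <= n /\ limZ z).
Proof.
move=> ch AO; have ca := ga_dec ga; have cb := dec2_bit; have cW := dec3_Wb.
(* A number [y] of the guess at [s] is accepted once an agreement up to [y] is seen and the low part
   of its use is confirmed. *)
apply: (@eq_le_e (fun y => exists s,
  [&& n <= s, y <= s, a s y & agree a h s n y] /\
  forall z, z < s -> ~~ (inuse a h s n y z && (pi1 z <= n)) \/
    (pi1 z <= n /\ limZ z))).
  move=> y; split=> [[s [/and4P[ns ys ay ag] low]]|Ay].
    (* Soundness, by induction: when the smaller elements of the guess are in [A], the agreement up
       to [q] fires at some large good stage, so [q] is in the image of the operator, which is
       [A]. *)
    have ind q : q <= y -> a s q -> A q.
      elim/ltn_ind: q => q IH qy aq; apply/AO.
      have lowev : evt (fun t => forall z, z < s ->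
          inuse a h s n q z && (pi1 z <= n) -> inZ a h t z).
        apply: (evt_ball (P := fun t z =>
          inuse a h s n q z && (pi1 z <= n) -> inZ a h t z)) => z zs.
        case: (boolP (inuse a h s n q z && (pi1 z <= n))) => [|_]; last by exists 0.
        case/andP=> /bexP[q' q'q iz] zn.
        case: (low z zs) => [/negP[]|[_ /limZ_evt]]; last exact: evt_mono.
        by rewrite zn andbT; apply/bexP; exists q' => //; lia.
      have aev : evt (fun t => forall q', q' < q -> a s q' -> a t q').
        apply: (evt_ball (P := fun t q' => a s q' -> a t q')) => q' q'q.
        case: (boolP (a s q')) => [aq'|_]; last by exists 0.
        have /(ga_evt ga) : A q' by apply: IH aq' => //; lia.
        exact: evt_mono.
      have [t gt [lowt [at' st]]] :=
        evt_good (evt_and lowev (evt_and aev (evt_ge s))).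
      apply: (@fire_Om s t n q q) => //; first lia.
      apply/and3P; split.
      - by apply/ballP => q' q'q; apply: (ballP _ _ ag); lia.
      - by apply/ballP => q' q'q; apply/implyP/at'.
      - by apply/ballP => z zs; apply/implyP/lowt.
    exact: ind.
  (* Completeness: at a large good stage both [a] and [conv] are correct up to [y]. *)
  have agev : evt (fun s => forall q, q < y.+1 ->
      (A q -> a s q) /\ (Om n q -> conv a h s n q)).
    apply: (evt_ball (P := fun s q =>
      (A q -> a s q) /\ (Om n q -> conv a h s n q))) => q _; apply: evt_and.
      have [/(ga_evt ga)|no] := pselect (A q); first exact: evt_mono.
      by exists 0.
    have [/Om_conv|no] := pselect (Om n q); first exact: evt_mono.
    by exists 0.
  have [s gs [ags nys]] := evt_good (evt_and agev (evt_ge (maxn n y))).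
  exists s; split.
    apply/and4P; split; [lia|lia|by apply: (proj1 (ags y _))|].
    apply/ballP => q qy; have [h1 h2] := ags q qy.
    apply/andP; split; first by apply/implyP => /gs/AO/h2.
    by apply/implyP => cq; apply/h1/AO/(good_conv gs cq).
  move=> z zs; case: (boolP (_ && _)) => [/andP[iz zn]|]; last by left.
  right; split=> //; apply: (good_inZ gs).
  case/bexP: iz => q _ /andP[_ /bexP[c _ /andP[/andP[/andP[_ /ballP uc] _] cz]]].
  by have := uc z (bit_lt cz); rewrite cz.
apply: le_e_ex; apply: le_e_and.
  apply: le_e_dec.
  by rewrite /agree /conv /usable /inZ /subA; comp.
apply: (@le_e_ball pi2 (fun p z => ~~ (inuse a h (pi2 p) n (pi1 p) z &&
  (pi1 z <= n)) \/ (pi1 z <= n /\ limZ z))); first by comp.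
apply: le_e_or.
  apply: le_e_dec.
  by rewrite /inuse /use /usable /inZ /subA; comp.
apply: (@le_e_pre (fun z => pi1 z <= n /\ limZ z)); first by comp.
exact: le_e_refl.
Qed.

Lemma limZ_or z : limZ z -> V z \/ exists s t n y,
  [/\ good t, [/\ s <= t, n <= s & y <= s], fire a h s t n y,
      inuse a h s n y z & n < pi1 z].
Proof.
move=> [t gt]; rewrite hE => /orP[vz|]; first by left; apply: v_good gt vz.
case/bexP=> s st /bexP[n ns /bexP[y ys /and3P[f iz zn]]].
by right; exists s, t, n, y.
Qed.

End OneSet.

(** * Finite differences and columns *)

Lemma le_e_bounded (F X : set nat) b : (forall z, F z -> z < b) -> le_e F X.
Proof.
move=> /compr_exists[u uE]; have cb := dec2_bit.
apply: (@eq_le_e (fun z => bit u z)); first by move=> z; rewrite uE.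
by apply: (@le_e_dec (bit u)); apply: (dec_comp2 cb); comp.
Qed.

Lemma le_e_almost (S T X : set nat) b :
  (forall z, S z -> T z) -> (forall z, T z -> S z \/ z < b) ->
  le_e S X -> le_e T X.
Proof.
move=> ST TS SX.
apply: (@eq_le_e (fun z => S z \/ (T z /\ z < b))).
  move=> z; split=> [[/ST//|[]//]|Tz].
  by case: (TS z Tz); [left|right].
apply: le_e_or => //.
by apply: (@le_e_bounded _ _ b) => z [].
Qed.

Lemma almost_le_e (S T : set nat) b :
  (forall z, S z -> T z) -> (forall z, T z -> S z \/ z < b) -> le_e S T.
Proof.
move=> ST TS; have cb := dec2_bit.
have [|u uE] := @compr_exists (fun z => T z /\ ~ S z) b.
  by move=> z [Tz nS]; case: (TS z Tz).
apply: (@eq_le_e (fun z => T z /\ ~~ bit u z)).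
  move=> z; split=> [[Tz /negP nu]|Sz].
    by apply: contrapT => nS; apply: nu; apply/uE.
  by split; [apply: ST|apply/negP => /uE[]].
apply: le_e_and; first exact: le_e_refl.
by apply: (@le_e_dec (fun z => ~~ bit u z)); comp.
Qed.

Lemma le_e_columns (Z X : set nat) n :
  (forall m, m <= n -> le_e (fun i => Z (cpair m i)) X) ->
  le_e (fun z => pi1 z <= n /\ Z z) X.
Proof.
have col m : le_e (fun i => Z (cpair m i)) X ->
    le_e (fun z => pi1 z == m /\ Z (cpair m (pi2 z))) X.
  move=> ZX; apply: le_e_and; first by apply: le_e_dec; comp.
  by apply: (@le_e_pre (fun i => Z (cpair m i))); first by comp.
have zE z m : pi1 z = m -> cpair m (pi2 z) = z by move=> <-; apply: cpairK.
elim: n => [|n IH] ZX.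
  apply: eq_le_e (col 0 (ZX 0 isT)) => z; rewrite leqn0.
  by split=> -[/eqP e]; rewrite (zE _ _ e) e.
have {}IH := IH (fun m mn => ZX m (leqW mn)).
apply: eq_le_e (le_e_or (col n.+1 (ZX _ (leqnn _))) IH) => z.
split=> [[[/eqP e]|[le]]|[]].
- by rewrite (zE _ _ e) e.
- by split=> //; apply: leqW.
- rewrite leq_eqVlt => /orP[/eqP e|le] Zz; [left|right] => //.
  by rewrite (zE _ _ e) e.
Qed.

(** The parameter [x] runs a family of constructions inside one reduction to [A]. Finiteness in
    column [m] assumes something only of the earlier columns, so it also covers the first column of
    [V] that is not below [C]. *)
Lemma thickness (A C V : set nat) : Sigma02 A -> ~ le_e A C -> le_e V A ->
  exists2 Z, le_e Z A & forall x,
  [/\ forall z, V (cpair x z) -> Z (cpair x z),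
      forall m,
        (forall m', m' < m -> le_e (fun i => V (cpair x (cpair m' i))) C) ->
        exists b, forall i, Z (cpair x (cpair m i)) ->
          V (cpair x (cpair m i)) \/ i < b &
      (forall m, le_e (fun i => V (cpair x (cpair m i))) C) ->
        ~ le_e A (fun z => Z (cpair x z))].
Proof.
move=> /good_approx_exists[a ga] nAC /le_e_elim[R cR RE].
have ca := ga_dec ga; have cb := dec2_bit.
pose v x t z := (z < t) && bex t (fun k => R (cpair x z) k &&
  ball (pi1 k) (fun y => bit (pi1 k) y ==> a t y)).
have cv : dec3 v by rewrite /v; comp.
have vlt x t z : v x t z -> z < t by case/andP.
have [zs czs zsE] := stages_exist ca cv vlt.
pose Vx x : set nat := fun z => V (cpair x z).
have v_evt x z : Vx x z -> evt (fun t => v x t z).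
  move=> /RE[k Rk sub].
  have ev : evt (fun t => forall y, y < pi1 k -> bit (pi1 k) y -> a t y).
    apply: (evt_ball (P := fun t y => bit (pi1 k) y -> a t y)) => y _.
    case: (boolP (bit (pi1 k) y)) => [/sub/(ga_evt ga)|_]; first exact: evt_mono.
    by exists 0.
  apply: evt_mono (evt_and ev (evt_ge (maxn z k).+1)) => t [ht lt].
  apply/andP; split; first lia.
  apply/bexP; exists k; first lia.
  by rewrite Rk; apply/ballP => y yk; apply/implyP/ht.
have v_good x t z : good A a t -> v x t z -> Vx x z.
  move=> gt /andP[_ /bexP[k _ /andP[Rk /ballP hk]]].
  apply/RE; exists k => // y by'; apply: gt.
  exact: (implyP (hk y (bit_lt by'))).
pose Z x := limZ A a (zs x).
exists (fun p => Z (pi1 p) (pi2 p)).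
  (* That a stage is good is a bounded positive condition on [A], which gives the reduction to
     [A]. *)
  apply: (@eq_le_e (fun p => exists t, zs (pi1 p) t (pi2 p) /\
      forall y, y < t -> ~~ a t y \/ A y)).
    move=> p; split=> [[t [hz gt]]|[t gt hz]]; exists t => //.
      by move=> y ay; case: (gt y (ga_lt ga ay)) => //; rewrite ay.
    split=> // y _; case: (boolP (a t y)) => [/gt|]; by [right|left].
  apply: le_e_ex; apply: le_e_and; first by apply: le_e_dec; comp.
  apply: (@le_e_ball pi2 (fun p y => ~~ a (pi2 p) y \/ A y)); first by comp.
  apply: le_e_or; first by apply: le_e_dec; comp.
  by apply: (@le_e_pre A); [comp|exact: le_e_refl].
move=> x.
have ZE z : Z (pi1 (cpair x z)) (pi2 (cpair x z)) = Z x z by rewrite !cpairE.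
have ZEf : (fun z => Z (pi1 (cpair x z)) (pi2 (cpair x z))) = Z x.
  by apply: funext => z; rewrite ZE.
have VZ z : Vx x z -> Z x z.
  by apply: (sub_limZ ga (zsE x) (v_evt x)).
(* By [low_columns], success of the [n]-th operator would enumerate [A] from the columns up to [n],
   hence from [C]. *)
have nA n : (forall m, m <= n -> le_e (fun i => Z x (cpair m i)) C) ->
    ~ (forall q, A q <-> enum_op (W n) (Z x) q).
  move=> /le_e_columns LC AO; apply: nAC; apply: le_e_trans LC.
  apply: (low_columns ga (zsE x)) AO.
  have -> : zs x = fun t z => zs x t z by [].
  by comp.
(* Only requirements [n < m] throw elements into column [m]; each acts finitely there, since the
   columns of [Z x] up to [n] are below [C] by induction. *)
have fin m : (forall m', m' < m -> le_e (fun i => Vx x (cpair m' i)) C) ->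
    exists b, forall i, Z x (cpair m i) -> Vx x (cpair m i) \/ i < b.
  elim/ltn_ind: m => m IH VC.
  have ZC m' : m' < m -> le_e (fun i => Z x (cpair m' i)) C.
    move=> m'm; have [b hb] := IH m' m'm (fun k km => VC k (ltn_trans km m'm)).
    by apply: (@le_e_almost _ _ _ b) (VC m' m'm) => // i; apply: VZ.
  have /choice[b bP] : forall n, exists b, n < m -> forall s t y z,
      good A a t -> s <= t -> n <= s -> y <= s ->
      fire a (zs x) s t n y -> inuse a (zs x) s n y z -> z < b.
    move=> n; case: (ltnP n m) => nm; last by exists 0.
    have [|b hb] := finite_dump ga (zsE x) (n := n).
      by apply: nA => k kn; apply: ZC; lia.
    by exists b.
  exists (\sum_(n < m) b n) => i /(limZ_or (zsE x) (v_good x))[|]; first by left.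
  move=> [s [t [n [y [gt [st ns ys] f iz]]]]]; rewrite cpairE => nm; right.
  have := bP n nm s t y _ gt st ns ys f iz.
  rewrite (bigD1 (Ordinal nm)) //=; have := cpair_ge m i; lia.
split=> [z /VZ|m VC|VC].
- by rewrite ZE.
- by have [b hb] := fin m VC; exists b => i; rewrite ZE => /hb.
- rewrite ZEf => /le_e_W[n AO]; apply: (nA n) AO => m _.
  have [b hb] := fin m (fun k _ => VC k).
  by apply: (@le_e_almost _ _ _ b) (VC m) => // i; apply: VZ.
Qed.

(** * High_2-ness *)

Lemma le_e_column (Z : set nat) m : le_e (fun i => Z (cpair m i)) Z.
Proof. by apply: le_e_pre (le_e_refl _); comp. Qed.

(** Column 0 codes [C], which keeps the constructed set in the interval; column [y + 1] is full if
    [y] is in [A] and finite otherwise. So [y] is outside [A] iff this column omits a point, a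
    question about the complement of a set below [B]. *)
Lemma compl_le_jump (A B C : set nat) : Sigma02 A -> le_e C A -> ~ le_e A C ->
  (forall Z, le_e C Z -> le_e Z A -> ~ le_e A Z -> le_e Z B) ->
  le_e (~` A) (jump B).
Proof.
move=> sA CA nAC below.
pose V p := let m := pi1 (pi2 p) in
  (m == 0 /\ C (pi2 (pi2 p))) \/ (0 < m /\ A m.-1).
have VA : le_e V A.
  apply: le_e_or; apply: le_e_and; try by apply: le_e_dec; comp.
    by apply: le_e_pre CA; comp.
  by apply: le_e_pre (le_e_refl _); comp.
have [Z ZA /(_ 0)[VZ fin nAZ]] := thickness sA nAC VA.
(* No uniformity in [m] is claimed: each column is [C], full or empty. *)
have Vcol m : le_e (fun i => V (cpair 0 (cpair m i))) C.
  rewrite /V; case: m => [|m].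
    by apply: eq_le_e (le_e_refl C) => i; rewrite !cpairE; split=> [|[[]|[]]]//; left.
  have [Am|nA] := pselect (A m).
    apply: (@eq_le_e (fun=> is_true true)).
      by move=> i; rewrite !cpairE; split=> // _; right.
    by apply: (@le_e_dec (fun=> true)); comp.
  by apply: (@le_e_bounded _ _ 0) => i; rewrite !cpairE => -[[]|[]].
pose Z0 z := Z (cpair 0 z).
have {}VZ z : V (cpair 0 z) -> Z0 z by apply: VZ.
have CZ : le_e C Z0.
  have [//|b hb] := fin 0.
  apply: le_e_trans (le_e_column Z0 0).
  apply: (@almost_le_e _ _ b) => i.
    by move=> Ci; apply: VZ; rewrite /V !cpairE; left.
  by move=> /hb; rewrite /V !cpairE => -[[[]|[]]|]//; [left|right].
have /le_e_jumpC nZ : le_e Z0 B.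
  apply: below => //; last exact: nAZ.
  by apply: le_e_pre ZA; comp.
apply: (@eq_le_e (fun y => exists i, (~` Z0) (cpair y.+1 i))).
  move=> y; split=> [[i nZi] Ay|nAy].
    by apply: nZi; apply: VZ; rewrite /V !cpairE; right.
  (* The bound itself is a missing point, as this column of [V] is empty. *)
  have [//|b hb] := fin y.+1; exists b => /hb.
  by rewrite /V !cpairE ltnn => -[[[]|[]]|].
by apply: le_e_ex; apply: le_e_pre nZ; comp.
Qed.

(** The normal form is applied twice. [P1] and [Q2] occur positively and stay c.e.; [Q1] and [P2]
    occur negatively, and their enumeration stages are absorbed by the universal quantifier. *)
Lemma Sigma3_form S : le_e S (jump (jump set0)) -> exists2 E, le_e E set0 &
  forall x, S x <-> exists a, forall b, E (cpair x (cpair a b)).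
Proof.
move=> /le_e_jump_elim[P [Q [/le_e_jump_elim[P1 [Q1 [P10 Q10 PE]]]]]].
move=> /le_e_jump_elim[P2 [Q2 [P20 Q20 QE]]] SE.
have [q1 cq1 q1E] := le_e_set0_elim Q10.
have [p2 cp2 p2E] := le_e_set0_elim P20.
(* [p] codes [x], then the two existential witnesses for [S] and [P], then a potential witness for
   [Q] together with a stage. *)
pose xa p := cpair (pi1 p) (pi1 (pi1 (pi2 p))).
pose k p := pi2 (pi1 (pi2 p)).
pose j p := pi1 (pi2 (pi2 p)).
pose b p := pi2 (pi2 (pi2 p)).
exists (fun p => P1 (cpair (xa p) (k p)) /\
  (~~ q1 (cpair (xa p) (k p)) (b p) /\
   (~~ p2 (cpair (xa p) (j p)) (b p) \/ Q2 (cpair (xa p) (j p))))).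
  rewrite /xa /k /j /b.
  apply: le_e_and; first by apply: le_e_pre P10; comp.
  apply: le_e_and; first by apply: le_e_dec; comp.
  apply: le_e_or; first by apply: le_e_dec; comp.
  by apply: le_e_pre Q20; comp.
move=> x; rewrite SE; split=> [[a [/PE[c [hP1 hQ1]] nQ]]|[ac h]].
  exists (cpair a c) => d; rewrite /xa /k /j /b !cpairE; split=> //; split.
    by apply/negP => q; apply/hQ1/q1E; exists (pi2 d).
  case: (boolP (p2 _ _)) => [p2h|]; last by left.
  right; apply: contrapT => nQ2; apply/nQ/QE; exists (pi1 d).
  by split=> //; apply/p2E; exists (pi2 d).
exists (pi1 ac); split.
  apply/PE; exists (pi2 ac); split.
    by have [] := h 0; rewrite /xa /k !cpairE.
  move=> /q1E[d q]; have [_ [/negP + _]] := h (cpair 0 d).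
  by rewrite /xa /k /b !cpairE.
move=> /QE[d [/p2E[e p2h] nQ2]]; have [_ [_ +]] := h (cpair d e).
by rewrite /xa /j /b !cpairE p2h => -[].
Qed.

Lemma high2_of_interval (A B C : set nat) :
  Sigma02 A -> le_e C A -> ~ le_e A C -> ~ le_e A B ->
  (forall Z, le_e C Z -> le_e Z A -> ~ le_e A Z -> le_e Z B) -> high2 B.
Proof.
move=> sA CA nAC nAB below.
have KA := le_e_K A.
have [e eA] := le_e_W (le_e_refl A).
have AK : le_e A (K A).
  apply: (@eq_le_e (fun x => K A (cpair e x))); first by move=> x; rewrite KE eA.
  exact: le_e_column.
(* [K A] is equivalent to [A], and its complement bounds the complement of every set below [A]. *)
have nKB : le_e (~` K A) (jump B).
  apply: (@compl_le_jump (K A) B C).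
  - exact: le_e_trans KA sA.
  - exact: le_e_trans CA AK.
  - by move=> KC; apply: nAC; apply: le_e_trans KC.
  - move=> Z CZ ZK nKZ; apply: below => //; first exact: le_e_trans ZK KA.
    by move=> AZ; apply: nKZ; apply: le_e_trans AZ.
have negA S : le_e S A -> le_e (~` S) (jump B).
  move=> /le_e_W[f fS]; apply: le_e_trans nKB.
  apply: (@eq_le_e (fun x => (~` K A) (cpair f x))).
    by move=> x; rewrite /setC /= KE fS.
  exact: le_e_column.
have posA S : le_e S A -> le_e S (jump B).
  move=> SA; apply: le_e_trans SA _; apply: le_e_trans sA _.
  exact: jump_le_e (le_e_set0 B).
have KS := le_e_K (jump (jump set0)); set S := K _ in KS.
(* The positive half of the third jump is handled by monotonicity of the jump. *)
suff nS : le_e (~` S) (jump (jump B)).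
  rewrite /high2 {1}/jump -/S; apply: join_le_e nS.
  apply: le_e_trans KS _; do 2 apply: jump_le_e.
  exact: le_e_set0.
have [E E0 SE] := Sigma3_form KS.
(* After column 0, which is [C], column [m + 1] is [A] if [m] witnesses that [x] is in [S], and
   finite otherwise. *)
pose V p := let x := pi1 p in let m := pi1 (pi2 p) in let i := pi2 (pi2 p) in
  (m == 0 /\ C i) \/
  (0 < m /\ (A i /\ forall b, b < i.+1 -> E (cpair x (cpair m.-1 b)))).
have VA : le_e V A.
  have EA := le_e_trans E0 (le_e_set0 A).
  apply: le_e_or; apply: le_e_and; try by apply: le_e_dec; comp.
    by apply: le_e_pre CA; comp.
  apply: le_e_and; first by apply: le_e_pre (le_e_refl _); comp.
  apply: (@le_e_ball (fun p => (pi2 (pi2 p)).+1)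
    (fun p b => E (cpair (pi1 p) (cpair (pi1 (pi2 p)).-1 b)))); first by comp.
  by apply: le_e_pre EA; comp.
have [Z ZA ZP] := thickness sA nAC VA.
have Vcol0 x : le_e (fun i => V (cpair x (cpair 0 i))) C.
  apply: eq_le_e (le_e_refl C) => i; rewrite /V !cpairE.
  by split=> [|[[]|[]]]//; left.
have VcolS x m : ~ (forall b, E (cpair x (cpair m b))) ->
    le_e (fun i => V (cpair x (cpair m.+1 i))) C.
  move=> /existsNP[b nb]; apply: (@le_e_bounded _ _ b) => i.
  rewrite /V !cpairE => -[[]//|[_ [_ Eb]]].
  by rewrite ltnNge; apply/negP => bi; apply/nb/Eb.
(* Inequality of the [x]-th set with the [u]-th set enumerated from [B]. Both sets and their
   complements are below the jump of [B], so the negation of [D] is available one jump higher. *)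
pose D x u := exists z, (Z (cpair x z) /\ (~` K B) (cpair u z)) \/
  ((~` Z) (cpair x z) /\ K B (cpair u z)).
have DB : le_e (fun p => D (pi1 p) (pi2 p)) (jump B).
  have KB := le_e_K B.
  apply: le_e_ex; apply: le_e_or; apply: le_e_and.
  - by apply: le_e_pre (posA _ ZA); comp.
  - by apply: le_e_pre (le_e_jumpC KB); comp.
  - by apply: le_e_pre (negA _ ZA); comp.
  - by apply: le_e_pre (le_e_jump KB); comp.
apply: (@eq_le_e (fun x => exists u, ~ D x u)); last first.
  by apply: le_e_ex; apply: le_e_jumpC.
move=> x; have [VZ fin nAZ] := ZP x.
pose Zx z := Z (cpair x z).
split=> [[u nD] Sx|nSx].
  have ex : exists a, `[<forall b, E (cpair x (cpair a b))>].
    by move/SE: Sx => [a h]; exists a; apply/asboolP.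
  (* For the least witness the earlier columns are below [C], so [fin] makes column [a + 1] a finite
     variant of [A], and a reduction of [Zx] to [B] would give one of [A]. *)
  have [a /asboolP Ea amin] := ex_minnP ex.
  have [|b hb] := fin a.+1.
    move=> [|m] ma //; apply: VcolS => Em.
    by have := amin m (introT (asboolP _) Em); rewrite leqNgt -ltnS ma.
  apply: nAB; apply: (@le_e_trans Zx).
    apply: le_e_trans (le_e_column Zx a.+1).
    apply: (@almost_le_e _ _ b) => i.
      by move=> Ai; apply: VZ; rewrite /V !cpairE; right.
    by move=> /hb; rewrite /V !cpairE => -[[[]|[_ []]]|]//; [left|right].
  apply: (@eq_le_e (fun z => K B (cpair u z))).
    move=> z; split=> h; apply: contrapT => nh; apply: nD; exists z.
      by right.
    by left.
  by apply: le_e_pre (le_e_K B); comp.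
(* Without a witness all columns of [V] at [x] are below [C]; then [Zx] bounds [C] but not [A], and
   the interval hypothesis supplies the index [u]. *)
have CZ : le_e C Zx.
  have [//|b hb] := fin 0.
  apply: le_e_trans (le_e_column Zx 0).
  apply: (@almost_le_e _ _ b) => i.
    by move=> Ci; apply: VZ; rewrite /V !cpairE; left.
  by move=> /hb; rewrite /V !cpairE => -[[[]|[]]|]//; [left|right].
have /le_e_W[u uE] : le_e Zx B.
  apply: below => //.
    by apply: le_e_pre ZA; comp.
  apply: nAZ => -[|m] //; apply: VcolS => Em.
  by apply/nSx/SE; exists m.
exists u => -[z [[/uE h]|[h]]]; rewrite /setC /= KE //.
by move/uE.
Qed.

Theorem theorem5p7 (n : nat) (A : set nat) (B : 'I_n -> set nat)
    (hA : Sigma02 A) (hB : forall i : 'I_n, Sigma02 (B i)) :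
  (Ahmad_pair A B -> forall i : 'I_n, essential A B i -> high2 (B i)) /\
  (proper_Ahmad_pair A B -> forall j : 'I_n, high2 (B j)).
Proof.
have main : Ahmad_pair A B -> forall i : 'I_n, essential A B i -> high2 (B i).
  move=> [nAB below] i [C [[CA nAC] _ nCB]].
  apply: (@high2_of_interval A (B i) C) => // Z CZ ZA nAZ.
  have [j ZB] := below Z (conj ZA nAZ).
  (* For [j] other than [i], a reduction of [Z] to [B j] would put [C] below [B j]. *)
  have [<-//|/nCB[]] := pselect (j = i).
  exact: le_e_trans CZ ZB.
by split=> // -[pair ess] j; apply: main.
Qed.
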